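(* Let $W\in\mathbb{R}^{m\times n}$ have iid standard normal entries and let $m/n\to c$ as $n\to\infty$. If $c<c^*$, then the probability that the map $x\mapsto\operatorname{ReLU}(Wx)$, $\mathbb{R}^n\to\mathbb{R}^m$, is not injective tends to $1$ as $n\to\infty$, where $c^*$ is the unique positive real solution of $\frac12\mathrm{erfc}\!\left(\frac{1}{\sqrt{2c}}\right)=\frac1c$ (numerically $c^*\approx 3.4$).
   Context: $\operatorname{ReLU}(y)=\max(y,0)$ componentwise; $\mathrm{erfc}(z)=1-\frac{2}{\sqrt\pi}\int_0^z e^{-t^2}\,dt$. *)

(* Defs.v *)
From HB Require Import structures.
From mathcomp Require Import all_boot all_order all_algebra.
From mathcomp Require Import all_classical all_reals all_analysis.
Set Implicit Arguments. Unset Strict Implicit. Unset Printing Implicit Defensive.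
Import Order.TTheory GRing.Theory Num.Theory.
Import numFieldNormedType.Exports.
Local Open Scope classical_set_scope.
Local Open Scope ring_scope.

Definition ReLU {R : realType} {m : nat} (y : 'cV[R]_m) : 'cV[R]_m :=
  map_mx (fun t => Num.max t 0) y.

Definition erfc {R : realType} (z : R) : R :=
  1 - 2 / Num.sqrt pi *
      (if 0 <= z then Rintegral lebesgue_measure `[0, z] (fun t => expR (- t ^+ 2))
       else - Rintegral lebesgue_measure `[z, 0] (fun t => expR (- t ^+ 2))).

Definition std_normal_rv {R : realType} d (T : measurableType d)
  (P : probability T R) (X : T -> R) : Prop :=
  measurable_fun setT X /\
  forall A : set R, measurable A -> P (X @^-1` A) = normal_prob 0 1 A.

(* Mutual independence of a finite family of real random variables:
   the product rule over every choice of measurable sets (taking B i = setT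
   recovers every subfamily). *)
Definition mutually_independent {R : realType} d (T : measurableType d)
  (P : probability T R) (I : finType) (X : I -> T -> R) : Prop :=
  forall B : I -> set R, (forall i, measurable (B i)) ->
    P (\bigcap_(i in [set: I]) (X i @^-1` B i)) =
    (\prod_(i : I) P (X i @^-1` B i))%E.

Definition rand_mx {R : realType} {T : Type} (m n : nat)
  (X : 'I_m * 'I_n -> T -> R) (w : T) : 'M[R]_(m, n) :=
  \matrix_(i, j) X (i, j) w.

(* Main.v *)
(* Let [w_1, .., w_m] be the rows of [W], [S] their sum and [x = - S].  Call the
   row [i] bad if [w_i . S <= 0].  If fewer than [n] rows are bad, there is a
   nonzero [u] orthogonal to all bad rows, and [ReLU (W (x + t u)) = ReLU (W x)]
   for small [t].  So it suffices to bound the probability that at least [n]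
   rows are bad; by the [k]-th factorial moment it is at most
   [C(m, k) / C(n, k)] times the largest probability that all rows of a given
   set [B] of [k] rows are bad.

   Write [S = U + V] with [U] the sum of the rows in [B].  Up to exponentially
   small probabilities, [w_i . U >= (1 - o(1)) n] for [i] in [B] (by polarization
   and concentration of squared norms) and [|V|^2 <= (1 + o(1)) n m].  Given [V]
   the numbers [w_i . V] are independent centred normal variables of variance
   [|V|^2], so all rows in [B] are bad with probability at most
   [Q(1 / sqrt c* )^k = (1 / c* )^k] up to a vanishing error, where [Q] is the
   standard normal tail.  As [n] grows the bound becomes [(c / c* )^k], which is
   arbitrarily small for large [k]. *)
Require Import Defs.
From HB Require Import structures.
From mathcomp Require Import all_boot all_order all_algebra.
From mathcomp Require Import all_classical all_reals all_analysis.
From mathcomp Require Import measurable_realfun ring lra.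
Import Order.TTheory GRing.Theory Num.Theory.
Import numFieldNormedType.Exports.
Local Open Scope classical_set_scope.
Local Open Scope ring_scope.
Set Implicit Arguments.
Unset Strict Implicit.
Unset Printing Implicit Defensive.

(** * Affine changes of variable for the Lebesgue measure *)

Section lebesgue_affine.
Context {R : realType}.
Implicit Types (a b x : R) (A : set R) (f : R -> \bar R).
Local Notation mu := (@lebesgue_measure R).
Local Open Scope ereal_scope.

Lemma measurable_affine a b :
  measurable_fun [set: measurableTypeR R]
    ((fun x => a * x + b)%R : measurableTypeR R -> measurableTypeR R).
Proof. by apply: measurable_funD => //; exact: measurable_funM. Qed.

(** Both sides are measures in [A], so by uniqueness of the Lebesgue measure they need only be
    compared on intervals []l, r]]. For negative [a] the preimage of such an interval is closed on
    the left and open on the right. *)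
Lemma lebesgue_measure_affine a b A : a != 0%R -> measurable A ->
  mu A = `|a|%:E * mu ((fun x => a * x + b)%R @^-1` A).
Proof.
move=> a0 mA.
pose m1 : {measure set (measurableTypeR R) -> \bar R} :=
  pushforward mu ((fun x => a * x + b)%R : measurableTypeR R -> measurableTypeR R).
pose c : {nonneg R} := NngNum (normr_ge0 a).
pose m2 : {measure set (measurableTypeR R) -> \bar R} :=
  mscale c (m1 (measurable_affine a b)).
rewrite [RHS](_ : _ = m2 A)//.
apply: lebesgue_measure_unique mA => _ [[l r] _ <-].
rewrite /m2 /= /mscale /= /m1 /pushforward /=.
have [ap|an|] := ltgtP a 0%R; last by move/eqP; rewrite (negbTE a0).
- rewrite (_ : _ @^-1` _ = `[(r - b) / a, (l - b) / a[%classic)%R; last first.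
    apply/seteqP; split => x /=; rewrite !in_itv /= ler_ndivrMr// ltr_ndivlMr//;
      by rewrite (mulrC x) lerBrDr ltrBlDr andbC.
  rewrite !lebesgue_measure_itv /= !lte_fin ltr_nM2r ?invr_lt0// ltrD2r.
  case: ifP => lr; rewrite ?mule0// -EFinD -EFinD -EFinM; congr EFin.
  by rewrite ltr0_norm//; field.
- rewrite (_ : _ @^-1` _ = `](l - b) / a, (r - b) / a]%classic)%R; last first.
    apply/seteqP; split => x /=; rewrite !in_itv /= ler_pdivlMr// ltr_pdivrMr//;
      by rewrite (mulrC x) lerBrDr ltrBlDr.
  rewrite !lebesgue_measure_itv /= !lte_fin ltr_pM2r ?invr_gt0// ltrD2r.
  case: ifP => lr; rewrite ?mule0// -EFinD -EFinD -EFinM; congr EFin.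
  by rewrite gtr0_norm//; field.
Qed.

Lemma ge0_integral_affine a b f : a != 0%R ->
  measurable_fun [set: measurableTypeR R] f -> (forall x, 0 <= f x) ->
  \int[mu]_x f x = `|a|%:E * \int[mu]_x f (a * x + b)%R.
Proof.
move=> a0 mf f0.
pose g := ((fun x => a * x + b)%R : measurableTypeR R -> measurableTypeR R).
pose m1 : {measure set (measurableTypeR R) -> \bar R} := pushforward mu g.
pose c : {nonneg R} := NngNum (normr_ge0 a).
transitivity (\int[mscale c (m1 (measurable_affine a b))]_x f x).
  by apply: eq_measure_integral => A mA _; exact: lebesgue_measure_affine.
rewrite ge0_integral_mscale//=; congr (_ * _).
rewrite ge0_integral_pushforward//; exact: measurable_affine.
Qed.

End lebesgue_affine.

(** * Integration against a measure given by a density *)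

Section density.
Local Open Scope ereal_scope.
Context d (T : measurableType d) (R : realType).
Variables (mu nu : {measure set T -> \bar R}) (g : T -> R).
Hypotheses (mg : measurable_fun setT g) (g0 : forall x, (0 <= g x)%R).
Hypothesis nuE : forall A, measurable A -> nu A = \int[mu]_(x in A) (g x)%:E.

Import HBNNSimple.

(** Simple functions come first, with [nuE] applied to each level set; monotone convergence along
    [nnsfun_approx] does the rest, the products with [g] staying increasing because [g] is
    nonnegative. *)
Lemma ge0_integral_density (f : T -> \bar R) :
  measurable_fun setT f -> (forall x, 0 <= f x) ->
  \int[nu]_x f x = \int[mu]_x (f x * (g x)%:E).
Proof.
move=> mf f0; pose f_ := nnsfun_approx measurableT mf.
have simple (h : {nnsfun T >-> R}) :
    \int[nu]_x (h x)%:E = \int[mu]_x ((h x)%:E * (g x)%:E).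
  under eq_integral do rewrite fimfunE -fsumEFin//.
  under [RHS]eq_integral do rewrite fimfunE -fsumEFin//.
  rewrite ge0_integral_fsum//; last 2 first.
  - by move=> r; exact/measurable_EFinP/measurable_funM.
  - by move=> r x _; rewrite EFinM; exact: nnfun_muleindic_ge0.
  transitivity (\sum_(r \in range h) \int[mu]_x
     ((r * \1_(h @^-1` [set r]) x)%:E * (g x)%:E)); last first.
    rewrite -ge0_integral_fsum//; last 2 first.
    - move=> r; apply/measurable_EFinP/measurable_funM => //.
      exact/measurable_funM.
    - move=> r x _; apply: mule_ge0; rewrite ?lee_fin//.
      by have := nnfun_muleindic_ge0 h r x; rewrite -EFinM lee_fin.
    apply: eq_integral => x _; rewrite ge0_mule_fsuml// => r.
    by have := nnfun_muleindic_ge0 h r x; rewrite -EFinM.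
  apply: eq_fsbigr => r /set_mem [x _ hr].
  have r0 : (0 <= r)%R by rewrite -hr.
  have mh : measurable (h @^-1` [set r]) by exact: measurable_sfunP.
  under eq_integral do rewrite EFinM.
  rewrite ge0_integralZl//; last 1 first.
  - exact/measurable_EFinP/measurable_indic.
  rewrite integral_indic// setIT nuE// integral_mkcond -ge0_integralZl//; last 2 first.
  - apply/(measurable_restrictT _ _).1 => //.
    exact/measurable_EFinP/measurable_funTS.
  - by move=> y _; rewrite patchE; case: ifP => //; rewrite lee_fin.
  apply: eq_integral => y _; rewrite patchE indicE.
  by case: ifP => _; rewrite ?mule0 ?mulr1 ?mulr0 ?mul0e.
transitivity (limn (fun n => \int[nu]_x (f_ n x)%:E)).
  rewrite -monotone_convergence//.
  - by apply: eq_integral => y _; apply/esym/cvg_lim => //;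
      exact: cvg_nnsfun_approx.
  - by move=> n; exact/measurable_EFinP.
  - by move=> n y _; rewrite lee_fin.
  - by move=> y _ m n mn; rewrite lee_fin; exact/lefP/nd_nnsfun_approx.
under eq_fun do rewrite simple.
rewrite -monotone_convergence//.
- apply: eq_integral => y _; apply/cvg_lim => //.
  by apply: cvgeZr => //; exact: cvg_nnsfun_approx.
- move=> n; apply: emeasurable_funM; exact/measurable_EFinP.
- by move=> n y _; rewrite mule_ge0// lee_fin.
- move=> y _ m n mn; apply: lee_wpmul2r; rewrite ?lee_fin//.
  exact/lefP/nd_nnsfun_approx.
Qed.

End density.

(** * The standard normal law *)

Section standard_normal.
Context {R : realType}.
Implicit Types (a b r s t x y z : R) (A : set R) (f : R -> \bar R).
Local Notation mu := (@lebesgue_measure R).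
Local Notation phi := (@normal_pdf R 0 1).
Local Notation gauss := (@normal_prob R 0 1).
Local Open Scope ereal_scope.

Lemma std_normal_pdfE x : phi x = (normal_peak 1 * expR (- x ^+ 2 / 2))%R.
Proof.
rewrite normal_pdfE ?oner_neq0//; congr (_ * expR _)%R.
by rewrite subr0 expr1n.
Qed.

(** Rotation invariance of the planar normal density, the source of [std_normal_conv]. *)
Lemma std_normal_pdf_rot x y x' y' : (x ^+ 2 + y ^+ 2 = x' ^+ 2 + y' ^+ 2)%R ->
  (phi x * phi y = phi x' * phi y')%R.
Proof.
move=> h; rewrite !std_normal_pdfE mulrACA [RHS]mulrACA -!expRD; congr (_ * expR _)%R.
by rewrite -!mulrDl -!opprD h.
Qed.

Lemma measurable_std_normal_pdf : measurable_fun [set: measurableTypeR R] phi.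
Proof. exact: measurable_normal_pdf. Qed.

Lemma std_normal_probE A : measurable A ->
  gauss A = \int[mu]_x ((\1_A x)%:E * (phi x)%:E).
Proof.
move=> mA; rewrite /normal_prob integral_mkcond; apply: eq_integral => x _.
by rewrite patchE indicE; case: ifP => _; rewrite ?mul1e ?mul0e.
Qed.

Lemma ge0_integral_std_normal f :
  measurable_fun [set: measurableTypeR R] f -> (forall x, 0 <= f x) ->
  \int[gauss]_x f x = \int[mu]_x (f x * (phi x)%:E).
Proof.
move=> mf f0; apply: ge0_integral_density => //.
- exact: measurable_std_normal_pdf.
- by move=> x; exact: normal_pdf_ge0.
Qed.

Lemma integral_std_normal_pdf_affine a b : a != 0%R ->
  `|a|%:E * \int[mu]_x (phi (a * x + b))%:E = 1.
Proof.
move=> a0; rewrite -(@ge0_integral_affine _ a b (fun x => (phi x)%:E))//.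
- exact: integral_normal_pdf.
- by apply/measurable_EFinP; exact: measurable_std_normal_pdf.
- by move=> x; rewrite lee_fin normal_pdf_ge0.
Qed.

Lemma std_normal_probN A : measurable A -> gauss (-%R @^-1` A) = gauss A.
Proof.
move=> mA.
have mNA : measurable (-%R @^-1` A).
  have mN : measurable_fun setT (-%R : measurableTypeR R -> measurableTypeR R).
    by [].
  by rewrite -[X in measurable X]setTI; exact: mN.
rewrite !std_normal_probE//.
rewrite [RHS](@ge0_integral_affine _ (-1) 0)//; last 2 first.
- apply: emeasurable_funM; apply/measurable_EFinP => //.
  exact: measurable_std_normal_pdf.
- by move=> x; rewrite mule_ge0// lee_fin ?normal_pdf_ge0.
rewrite normrN1 mul1e; apply: eq_integral => x _.
rewrite mulN1r addr0 !indicE; congr (_ * _).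
by rewrite !std_normal_pdfE sqrrN.
Qed.

(** With [k ^+ 2 = 1 - 2 * t] one has [expR (t * x ^+ 2) * phi x = phi (k * x)], whose integral is
    [k^-1] by rescaling. *)
Lemma std_normal_mgf_sqr t : (t < 2^-1)%R ->
  \int[gauss]_x (expR (t * x ^+ 2))%:E = (Num.sqrt (1 - 2 * t))^-1%:E.
Proof.
move=> t2; set k := Num.sqrt _.
have k0 : (0 < k)%R by rewrite sqrtr_gt0; lra.
have k2 : (k ^+ 2 = 1 - 2 * t)%R by rewrite sqr_sqrtr//; lra.
rewrite ge0_integral_std_normal; last 2 first.
- apply/measurable_EFinP; apply: measurableT_comp => //.
  by apply: measurable_funM => //; exact: measurable_funX.
- by move=> x; rewrite lee_fin expR_ge0.
have := @integral_std_normal_pdf_affine k 0%R (lt0r_neq0 k0).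
rewrite gtr0_norm// => h.
rewrite -[RHS]mule1 -h muleA -EFinM mulVf ?gt_eqF// mul1e.
apply: eq_integral => x _; rewrite -EFinM !std_normal_pdfE mulrCA -expRD.
by congr (_ * expR _)%:E; rewrite addr0 exprMn k2; field.
Qed.

(* The substitution [y = (r u - s x) / a] followed by the swap of [x] and [u]
   is a rotation of the plane, under which the density is invariant. *)
Lemma std_normal_conv s a r A : a != 0%R -> (r ^+ 2 = s ^+ 2 + a ^+ 2)%R ->
  measurable A ->
  \int[gauss]_x gauss ((fun y => s * x + a * y)%R @^-1` A) =
  gauss (( *%R r) @^-1` A).
Proof.
move=> a0 r2 mA.
have r0 : r != 0%R.
  rewrite -sqrf_eq0 r2 gt_eqF// ltr_wpDl ?sqr_ge0//.
  by rewrite lt0r sqrf_eq0 a0 sqr_ge0.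
have ra0 : (r / a != 0)%R by rewrite mulf_neq0// invr_eq0.
have mpre (h : measurableTypeR R -> measurableTypeR R) :
    measurable_fun setT h -> measurable (h @^-1` A).
  by move=> mh; rewrite -[X in measurable X]setTI; exact: mh.
have mphi := measurable_std_normal_pdf.
have inner x : gauss ((fun y => s * x + a * y)%R @^-1` A) =
    `|r / a|%:E * \int[mu]_u ((\1_A (r * u) * phi (r / a * u - s * x / a))%R)%:E.
  have mB : measurable ((fun y => s * x + a * y)%R @^-1` A).
    by apply: mpre; apply: measurable_funD => //; exact: measurable_funM.
  rewrite std_normal_probE//.
  rewrite (@ge0_integral_affine _ (r / a) (- (s * x / a)))//; last 2 first.
  - by apply: emeasurable_funM; apply/measurable_EFinP.
  - by move=> y; rewrite mule_ge0// lee_fin ?normal_pdf_ge0.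
  congr (_ * _); apply: eq_integral => u _; rewrite EFinM; congr (_ * _).
  rewrite (_ : r * u = s * x + a * (r / a * u + - (s * x / a)))%R//.
  by field.
pose F (p : measurableTypeR R * measurableTypeR R) : \bar R :=
  (`|r / a| * (\1_A (r * p.2) * phi (r / a * p.2 - s * p.1 / a)) * phi p.1)%R%:E.
have mF : measurable_fun setT F.
  apply/measurable_EFinP; apply: measurable_funM; last first.
    by apply: measurableT_comp => //; exact: measurable_fst.
  apply: measurable_funM => //; apply: measurable_funM.
    apply: measurableT_comp; first exact: measurable_indic.
    by apply: measurable_funM => //; exact: measurable_snd.
  apply: measurableT_comp => //; apply: measurable_funB.
    by apply: measurable_funM => //; exact: measurable_snd.
  apply: measurable_funM => //; apply: measurable_funM => //.
have F0 p : 0 <= F p by rewrite lee_fin !mulr_ge0// ?normal_pdf_ge0.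
have mF1 x : measurable_fun [set: measurableTypeR R]
    (fun u => (\1_A (r * u) * phi (r / a * u - s * x / a))%R%:E).
  apply/measurable_EFinP; apply: measurable_funM.
    apply: measurableT_comp; first exact: measurable_indic.
    exact: measurable_funM.
  by apply: measurableT_comp => //; apply: measurable_funB => //;
    exact: measurable_funM.
transitivity (\int[mu]_x \int[mu]_u F (x, u)).
  rewrite ge0_integral_std_normal//.
  - apply: eq_integral => x _; rewrite inner -ge0_integralZl//; last 1 first.
    + by move=> u _; rewrite lee_fin mulr_ge0// normal_pdf_ge0.
    rewrite -ge0_integralZr//=; last 3 first.
    + exact: emeasurable_funM.
    + by move=> u _; rewrite mule_ge0// lee_fin mulr_ge0// normal_pdf_ge0.
    + by rewrite lee_fin normal_pdf_ge0.
  - have := @measurable_fun_fubini_tonelli_F _ _ _ _ R mu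
      (fun p : measurableTypeR R * measurableTypeR R =>
        (`|r / a| * (\1_A (r * p.2) * phi (r / a * p.2 - s * p.1 / a)))%R%:E).
    rewrite /fubini_F => h.
    under eq_fun do rewrite inner.
    under eq_fun => x do (rewrite -ge0_integralZl//;
      last by move=> u _; rewrite lee_fin mulr_ge0// normal_pdf_ge0).
    apply: h => [|p]; last by rewrite lee_fin !mulr_ge0// normal_pdf_ge0.
    apply/measurable_EFinP.
    apply: measurable_funM => //; apply: measurable_funM.
      apply: measurableT_comp; first exact: measurable_indic.
      by apply: measurable_funM => //; exact: measurable_snd.
    apply: measurableT_comp => //; apply: measurable_funB.
      by apply: measurable_funM => //; exact: measurable_snd.
    apply: measurable_funM => //; apply: measurable_funM => //.
rewrite (@fubini_tonelli _ _ _ _ _ mu mu F)//.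
have mrA : measurable (( *%R r) @^-1` A) by apply: mpre; exact: measurable_funM.
rewrite [RHS]std_normal_probE//.
apply: eq_integral => u _.
transitivity (\int[mu]_x (((\1_A (r * u) * phi u)%R)%:E *
    (`|r / a|%:E * (phi (r / a * x + (- (s * u / a))))%:E))).
  apply: eq_integral => x _; rewrite /F -!EFinM; congr EFin => /=.
  rewrite [LHS](_ : _ = `|r / a| * \1_A (r * u) *
    (phi (r / a * u - s * x / a) * phi x))%R; last by ring.
  rewrite (@std_normal_pdf_rot _ _ (r / a * x - s * u / a) u); first by ring.
  have e (v w : R) : ((r / a * v - s * w / a) ^+ 2 =
    (r ^+ 2 * v ^+ 2 - 2 * r * s * v * w + s ^+ 2 * w ^+ 2) / a ^+ 2)%R by field.
  by rewrite !e r2; field.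
(* What remains in [x] is an affinely rescaled density, of total mass one. *)
rewrite ge0_integralZl//; last 3 first.
- apply: emeasurable_funM => //; apply/measurable_EFinP.
  by apply: measurableT_comp => //; exact: measurable_affine.
- by move=> x _; rewrite -EFinM lee_fin mulr_ge0// normal_pdf_ge0.
- by rewrite lee_fin mulr_ge0// normal_pdf_ge0.
rewrite ge0_integralZl//; last 2 first.
- apply/measurable_EFinP; apply: measurableT_comp => //.
  exact: measurable_affine.
- by move=> x _; rewrite lee_fin normal_pdf_ge0.
by rewrite integral_std_normal_pdf_affine// mule1 -EFinM.
Qed.

End standard_normal.

(** * The normal tail in terms of [erfc] *)

Section normal_tail.
Context {R : realType}.
Implicit Types (t x z : R).
Local Notation mu := (@lebesgue_measure R).
Local Notation phi := (@normal_pdf R 0 1).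
Local Notation gauss := (@normal_prob R 0 1).
Local Open Scope ereal_scope.

(** Substituting [x = Num.sqrt 2 * t] turns the exponent [- x ^+ 2 / 2] into [- t ^+ 2]. *)
Lemma std_normal_itv_erf z : (0 <= z)%R ->
  gauss `[0%R, z] = ((Num.sqrt pi)^-1 *
    Rintegral mu `[0%R, z / Num.sqrt 2] (fun t => expR (- t ^+ 2)))%R%:E.
Proof.
move=> z0; set w := (z / _)%R.
have s2 : (0 < Num.sqrt 2 :> R)%R by rewrite sqrtr_gt0.
have sp : (0 < Num.sqrt pi :> R)%R by rewrite sqrtr_gt0 pi_gt0.
have mg : measurable_fun [set: R] (fun t : R => expR (- t ^+ 2)).
  exact: measurable_gauss_fun.
have ig : mu.-integrable `[0%R, w] (EFin \o (fun t => expR (- t ^+ 2))).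
  by apply: (integrableS measurableT) => //; exact: integrableT_gauss.
rewrite EFinM /Rintegral fineK; last exact: integrable_fin_num ig.
rewrite std_normal_probE//.
rewrite (@ge0_integral_affine _ (Num.sqrt 2) 0)//; last 2 first.
- apply: emeasurable_funM; apply/measurable_EFinP => //.
  exact: measurable_std_normal_pdf.
- by move=> x; rewrite mule_ge0// lee_fin ?normal_pdf_ge0.
rewrite [in RHS]integral_mkcond -!ge0_integralZl//=; last 4 first.
- apply/(measurable_restrictT _ _).1 => //.
  exact/measurable_EFinP/measurable_funTS.
- by move=> y _; rewrite patchE; case: ifP => //; rewrite lee_fin expR_ge0.
- apply: emeasurable_funM; apply/measurable_EFinP.
    apply: measurableT_comp; first exact: measurable_indic.
    exact: measurable_affine.
  apply: measurableT_comp; first exact: measurable_std_normal_pdf.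
  exact: measurable_affine.
- by move=> x _; rewrite mule_ge0// lee_fin ?normal_pdf_ge0.
apply: eq_integral => x _; rewrite addr0 patchE indicE.
have -> : ((Num.sqrt 2 * x)%R \in [set` `[0%R, z]%R]) =
    (x \in [set` `[0%R, w]%R]).
  apply/idP/idP; rewrite !inE /= !in_itv /= pmulr_rge0// /w ler_pdivlMr//;
  by rewrite mulrC.
case: ifP => _; rewrite ?mul0e ?mule0// mul1e -EFinM; congr EFin.
rewrite std_normal_pdfE /normal_peak expr1n mul1r exprMn sqr_sqrtr//.
rewrite -(mulr_natr pi) sqrtrM ?pi_ge0// gtr0_norm// invfM.
rewrite (_ : - (2 * x ^+ 2) / 2 = - x ^+ 2)%R; last by field.
by rewrite mulrA mulrCA divff ?gt_eqF// mulr1.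
Qed.

(** The line is cut at [- z], [0] and [z]. By symmetry the two outer pieces have equal mass, and so
    do the two inner ones, which [std_normal_itv_erf] evaluates; the total is one. *)
Lemma std_normal_tail z : (0 <= z)%R ->
  gauss `]-oo, (- z)%R] = (erfc (z / Num.sqrt 2) / 2)%R%:E.
Proof.
move=> z0.
have s2 : (0 < Num.sqrt 2 :> R)%R by rewrite sqrtr_gt0.
have sp : (0 < Num.sqrt pi :> R)%R by rewrite sqrtr_gt0 pi_gt0.
rewrite /erfc divr_ge0 ?(ltW s2)//.
have mphi (A : set R) : measurable_fun A (fun x => (phi x)%:E).
  apply/measurable_funTS/measurable_EFinP; exact: measurable_std_normal_pdf.
have e1 : gauss `]0%R, z] = gauss `[0%R, z].
  by rewrite /normal_prob integral_itv_obnd_cbnd.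
have e2 : gauss `](- z)%R, 0%R] = gauss `[0%R, z].
  rewrite -std_normal_probN// opp_preimage_itvbndbnd/= opprK oppr0.
  by rewrite /normal_prob integral_itv_bndo_bndc.
have e3 : gauss `]z, +oo[ = gauss `]-oo, (- z)%R].
  rewrite /normal_prob integral_itv_obnd_cbnd// -/(normal_prob _ _ _).
  by rewrite -std_normal_probN// opp_preimage_itvbndy/=.
have tot : gauss `]-oo, (- z)%R] + gauss `](- z)%R, 0%R] +
    (gauss `]0%R, z] + gauss `]z, +oo[) = 1.
  rewrite -measureU//; last first.
    by apply/seteqP; split => x //=; rewrite !in_itv/= => -[h1 /andP[h2 h3]]; lra.
  rewrite -measureU//; last first.
    by apply/seteqP; split => x //=; rewrite !in_itv/= andbT => -[/andP[h1 h2] h3]; lra.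
  rewrite -measureU//; last 3 first.
  - exact: measurableU.
  - exact: measurableU.
  - apply/seteqP; split => x //=; rewrite !in_itv/= andbT.
    by move=> -[] [h1|/andP[h1 h2]] [/andP[h3 h4]|h3]; lra.
  rewrite -(@probability_setT _ _ R gauss); congr (_ _).
  apply/seteqP; split => x //= _; rewrite !in_itv/= ?andbT.
  case: (leP x (- z)%R) => h1; first by left; left.
  case: (leP x 0%R) => h2; first by left; right.
  by case: (leP x z) => h3; right; [left|right].
move: tot; rewrite e1 e2 e3 std_normal_itv_erf//.
set I := Rintegral _ _ _.
have fp : gauss `]-oo, (- z)%R] \is a fin_num by exact: fin_num_measure.
rewrite -(fineK fp) -!EFinD => -[h]; congr EFin; move: h.
set p := fine _; set q := (_ * I)%R => h.
have -> : (2 / Num.sqrt pi * I = 2 * q)%R by rewrite /q; ring.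
by lra.
Qed.

End normal_tail.

(** * Independence of disjoint blocks of variables *)

Section independent_blocks.
Local Open Scope ereal_scope.
Context {R : realType} d (T : measurableType d) (P : probability T R).
Context (I : finType) (X : I -> T -> R).
Hypothesis mX : forall i, measurable_fun setT (X i).
Hypothesis indepX : mutually_independent P X.
Implicit Types J K : {set I}.

(** A pi-system generating the sigma-algebra of the variables indexed by [J]; on it independence is
    a plain product formula. *)
Definition cylinders J : set (set T) :=
  [set C | exists2 B : I -> set R, (forall i, measurable (B i)) &
    C = \bigcap_(i in [set i | i \in J]) (X i @^-1` B i)].

Lemma cylindersI J : setI_closed (cylinders J).
Proof.
move=> _ _ [B mB ->] [C mC ->]; exists (fun i => B i `&` C i).
  by move=> i; exact: measurableI.
by rewrite -bigcapI; apply: eq_bigcapr.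
Qed.

Lemma cylindersT J : cylinders J setT.
Proof. by exists (fun=> setT) => //; rewrite bigcapT. Qed.

Lemma cylinders_sub J K : J \subset K -> cylinders J `<=` cylinders K.
Proof.
move=> JK _ [B mB ->].
exists (fun i => if i \in J then B i else setT); first by move=> i; case: ifP.
apply/seteqP; split => w /= h i /= iK; last first.
  by have := h i (fintype.subsetP JK _ iK); rewrite iK.
by case: ifPn => // iJ; exact: h.
Qed.

Lemma measurable_cylinders J : cylinders J `<=` measurable.
Proof.
move=> _ [B mB ->]; apply: fin_bigcap_measurable => // i _.
by rewrite -[X in measurable X]setTI; exact: mX.
Qed.

Lemma probability_cylinder J (B : I -> set R) : (forall i, measurable (B i)) ->
  P (\bigcap_(i in [set i | i \in J]) (X i @^-1` B i)) =
  \prod_(i in J) P (X i @^-1` B i).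
Proof.
move=> mB; pose B' i := if i \in J then B i else setT.
rewrite (_ : \bigcap_(i in _) _ = \bigcap_(i in [set: I]) (X i @^-1` B' i)).
  rewrite indepX; last by move=> i; rewrite /B'; case: ifP.
  rewrite (bigID (mem J)) /= [X in _ * X]big1 ?mule1.
    by apply: eq_bigr => i iJ; rewrite /B' iJ.
  by move=> i /negbTE iJ; rewrite /B' iJ preimage_setT probability_setT.
apply/seteqP; split => w /= h i /= iJ; last first.
  by have := h i Logic.I; rewrite /B' iJ.
by rewrite /B'; case: ifPn => // iJ'; exact: h.
Qed.

(** Since [J] and [K] are disjoint, the two families of sets merge into one family [E], and the
    intersection is again a cylinder, over [J :|: K]. *)
Lemma cylinders_indep J K C D : [disjoint J & K]%B -> cylinders J C ->
  cylinders K D -> P (C `&` D) = P C * P D.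
Proof.
move=> JK [B mB ->] [B' mB' ->].
pose E i := if i \in J then B i else B' i.
have mE i : measurable (E i) by rewrite /E; case: ifP.
have KnJ i : i \in K -> (i \in J) = false.
  by move=> iK; apply/negbTE; rewrite (disjointFl JK).
have -> : \bigcap_(i in [set i | i \in J]) (X i @^-1` B i) =
          \bigcap_(i in [set i | i \in J]) (X i @^-1` E i).
  by apply: eq_bigcapr => i /= iJ; rewrite /E iJ.
have -> : \bigcap_(i in [set i | i \in K]) (X i @^-1` B' i) =
          \bigcap_(i in [set i | i \in K]) (X i @^-1` E i).
  by apply: eq_bigcapr => i /= iK; rewrite /E KnJ.
rewrite -bigcap_setU.
rewrite (_ : [set i | i \in J] `|` [set i | i \in K] =
             [set i | i \in (J :|: K)%SET])%classic; last first.
  by apply/seteqP; split => i /=; rewrite inE => /orP.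
rewrite !probability_cylinder// (bigID (mem J)) /=; congr (_ * _).
  by apply: eq_bigl => i; rewrite inE; case: (i \in J); rewrite ?andbF.
apply: eq_bigl => i; rewrite inE; case: (boolP (i \in K)) => iK.
  by rewrite orbT KnJ.
by rewrite orbF; case: (i \in J).
Qed.

(** As functions of [A], both sides are finite measures that agree on a pi-system containing [setT],
    hence on the sigma-algebra it generates. *)
Lemma indep_generated J (D : set T) : measurable D ->
  (forall C, cylinders J C -> P (C `&` D) = P C * P D) ->
  forall A, <<s cylinders J >> A -> P (A `&` D) = P A * P D.
Proof.
move=> mD h A sA.
have fD : (0 <= fine (P D))%R by exact: fine_ge0.
pose m2 : {measure set T -> \bar R} := mscale (NngNum fD) P.
have mm2 B : m2 B = P B * P D.
  by rewrite /m2 /= /mscale /= fineK ?fin_num_measure// muleC.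
rewrite -mm2.
have := @g_sigma_algebra_measure_unique _ R T (cylinders J)
  (@measurable_cylinders J) (fun=> setT) (fun=> cylindersT J) _
  (mrestr P mD) m2 (@cylindersI J) _ _ A sA.
apply.
- by apply/seteqP; split => // x _; exists 0%N.
- by move=> C cC; rewrite mm2; exact: h.
- by move=> k /=; rewrite /mrestr setTI ltey_eq fin_num_measure.
Qed.

Lemma sigma_cylinders_measurable J A : <<s cylinders J >> A -> measurable A.
Proof.
apply: smallest_sub; [exact: sigma_algebra_measurable|].
exact: measurable_cylinders.
Qed.

(** [indep_generated] is applied twice, passing from cylinders to generated sets first for one block
    and then for the other. *)
Lemma sigma_cylinders_indep J K A B : [disjoint J & K]%B ->
  <<s cylinders J >> A -> <<s cylinders K >> B -> P (A `&` B) = P A * P B.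
Proof.
move=> JK sA sB; apply: (indep_generated _ _ sA).
  exact: sigma_cylinders_measurable sB.
move=> C cC; rewrite setIC muleC; apply: (indep_generated _ _ sB).
  exact: measurable_cylinders cC.
by move=> D cD; rewrite setIC muleC; exact: (cylinders_indep JK).
Qed.

(** The sample space with the coarser sigma-algebra of block [J]: measurability from [TX J]
    expresses that a function depends only on the variables of that block. *)
Local Notation TX J := (g_sigma_algebraType (cylinders J)).

Lemma measurable_to_block J : measurable_fun setT (id : T -> TX J).
Proof.
by move=> _ A mA; rewrite setTI; exact: (@sigma_cylinders_measurable J).
Qed.

Lemma measurable_block_entry J i : i \in J ->
  measurable_fun setT (X i : TX J -> R).
Proof.
move=> iJ _ B mB; rewrite setTI; apply: sub_sigma_algebra.
exists (fun k => if k == i then B else setT); first by move=> k; case: ifP.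
apply/seteqP; split => w /=; last by move/(_ i iJ) => /=; rewrite eqxx.
by move=> h k /= _; case: eqP => [->|].
Qed.

Lemma measurable_block_sub J K d' (U : measurableType d') (f : T -> U) :
  J \subset K -> measurable_fun setT (f : TX J -> U) ->
  measurable_fun setT (f : TX K -> U).
Proof.
move=> JK mf _ B mB; rewrite setTI.
have := mf measurableT B mB; rewrite setTI; apply: sub_sigma_algebra2.
exact: cylinders_sub.
Qed.

Lemma measurable_block d' (U : measurableType d') J (f : T -> U) :
  measurable_fun setT (f : TX J -> U) -> measurable_fun setT f.
Proof.
move=> mf _ B mB; rewrite setTI.
by have := mf measurableT B mB; rewrite setTI; exact: sigma_cylinders_measurable.
Qed.

(** Independence means that the image of [P] under the diagonal map into [TX J * TX K] is the
    product of the two marginals. Tonelli's theorem then gives the iterated integral. *)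
Lemma ge0_integral_decouple J K (F : T -> T -> \bar R) : [disjoint J & K]%B ->
  measurable_fun [set: TX J * TX K] (fun p => F p.1 p.2) ->
  (forall w w', 0 <= F w w') ->
  \int[P]_w F w w = \int[P]_w \int[P]_w' F w w'.
Proof.
move=> JK mF F0.
pose idm J : {mfun T >-> TX J} :=
  HB.pack (id : T -> TX J) (isMeasurableFun.Build _ _ _ _ _ (@measurable_to_block J)).
pose PJ : probability (TX J) R := distribution P (idm J).
pose PK : probability (TX K) R := distribution P (idm K).
have mdiag : measurable_fun setT ((fun w => (w, w)) : T -> (TX J * TX K)%type).
  by apply: measurable_fun_pair; exact: measurable_to_block.
pose dm : {mfun T >-> (TX J * TX K)%type} :=
  HB.pack ((fun w => (w, w)) : T -> (TX J * TX K)%type)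
    (isMeasurableFun.Build _ _ _ _ _ mdiag).
pose PD : probability (TX J * TX K)%type R := distribution P dm.
have PDE A : measurable A -> (PJ \x PK) A = PD A.
  apply: product_measure_unique => B C mB mC.
  by rewrite [LHS](_ : _ = P (B `&` C))//; exact: (sigma_cylinders_indep JK).
transitivity (\int[PD]_p F p.1 p.2).
  by rewrite ge0_integral_distribution// => p; exact: F0.
transitivity (\int[PJ \x PK]_p F p.1 p.2).
  by apply: eq_measure_integral => A mA _; apply/esym; exact: PDE.
rewrite fubini_tonelli1//.
rewrite ge0_integral_distribution//; last 2 first.
- exact: measurable_fun_fubini_tonelli_F.
- by move=> w; apply: integral_ge0 => w' _; exact: F0.
apply: eq_integral => w _; rewrite /= /fubini_F ge0_integral_distribution//.
exact: (measurableT_comp mF (@measurable_pair1 _ _ (TX J) (TX K) w)).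
Qed.

Lemma ge0_integral_decouple_le J K (F : T -> T -> \bar R) (c : R) :
  [disjoint J & K]%B ->
  measurable_fun [set: TX J * TX K] (fun p => F p.1 p.2) ->
  (forall w w', 0 <= F w w') ->
  (forall w, \int[P]_w' F w w' <= c%:E) -> \int[P]_w F w w <= c%:E.
Proof.
move=> JK mF F0 Fc; rewrite (ge0_integral_decouple JK)//.
have mP : measurable_fun setT ((fun p => (p.1, p.2)) :
    TX J * T -> (TX J * TX K)%type).
  apply: measurable_fun_pair; first exact: measurable_fst.
  exact: (measurableT_comp (@measurable_to_block K) measurable_snd).
have mint : measurable_fun setT (fun w => \int[P]_w' F w w').
  apply: (@measurable_block _ _ J).
  apply: (@measurable_fun_fubini_tonelli_F _ _ (TX J) T R P
    (fun p => F p.1 p.2)) => //.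
  exact: (measurableT_comp mF mP).
apply: (@le_trans _ _ (\int[P]_w c%:E)).
  by apply: ge0_le_integral => // w _; exact: integral_ge0.
by rewrite integral_cst// [X in _ * X]probability_setT mule1.
Qed.

(** Induction on [r]: the first block is decoupled from the union [K] of the remaining ones, on
    which the remaining product depends. *)
Lemma ge0_integral_prod_blocks (L : eqType) (r : seq L) (J : L -> {set I})
    (f : L -> T -> R) : uniq r ->
  {in r &, forall k l, k != l -> [disjoint J k & J l]%B} ->
  {in r, forall l, measurable_fun setT (f l : TX (J l) -> R)} ->
  (forall l w, (0 <= f l w)%R) ->
  \int[P]_w (\prod_(l <- r) f l w)%R%:E = \prod_(l <- r) \int[P]_w (f l w)%:E.
Proof.
move=> ur dJ mf f0.
elim: r ur dJ mf => [_ _ _|k r IH /= /andP[kr ur] dJ mf].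
  rewrite big_nil; under eq_integral do rewrite big_nil.
  rewrite integral_cst// mul1e; exact: probability_setT.
rewrite big_cons; under eq_integral do rewrite big_cons.
pose K := (\bigcup_(l <- r) J l)%SET.
have JK : [disjoint J k & K]%B.
  rewrite /K; move: dJ kr; elim: {IH ur mf K} r => [|l r IHr] dJ.
    by rewrite big_nil finset.disjoints_subset finset.setC0 finset.subsetT.
  rewrite inE negb_or big_cons => /andP[kl kr].
  rewrite -finset.setI_eq0 finset.setIUr finset.setU_eq0 !finset.setI_eq0.
  apply/andP; split; first by apply: dJ; rewrite ?inE ?eqxx ?orbT.
  apply: IHr => // a b; rewrite !inE => /orP ha /orP hb.
  by apply: dJ; rewrite !inE;
    [case: ha => h | case: hb => h]; rewrite h ?orbT.
have mK : measurable_fun setT ((fun w => \prod_(l <- r) f l w)%R : TX K -> R).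
  apply: measurable_prod => l lr; apply: (@measurable_block_sub (J l)).
    by rewrite /K (big_rem l)//= finset.subsetUl.
  by apply: mf; rewrite inE lr orbT.
have p0 w : (0 <= \prod_(l <- r) f l w)%R by apply: prodr_ge0.
rewrite (@ge0_integral_decouple _ _
  (fun w w' => (f k w * \prod_(l <- r) f l w')%R%:E) JK)//; last 2 first.
- apply/measurable_EFinP; apply: measurable_funM.
    apply: (measurableT_comp (mf k _)); first by rewrite inE eqxx.
    exact: measurable_fst.
  exact: (measurableT_comp mK measurable_snd).
- by move=> w w'; rewrite lee_fin mulr_ge0.
rewrite -IH//; last 2 first.
- by move=> a b ar br; apply: dJ; rewrite inE ?ar ?br orbT.
- by move=> l lr; apply: mf; rewrite inE lr orbT.
have mfk := measurable_block (mf k (mem_head _ _)).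
rewrite -ge0_integralZr//; last 3 first.
- exact/measurable_EFinP.
- by move=> w _; rewrite lee_fin.
- by apply: integral_ge0 => w _; rewrite lee_fin.
apply: eq_integral => w _; under eq_integral do rewrite EFinM.
rewrite ge0_integralZl//.
- by apply/measurable_EFinP; exact: (measurable_block mK).
- by move=> w' _; rewrite lee_fin.
- by rewrite lee_fin.
Qed.

End independent_blocks.
Arguments measurable_block_entry {R d T I X} J {i}.

(** Measurability is asked only of the indices in [s], because variables outside a block need not be
    measurable for the sigma-algebra of that block. *)
Lemma measurable_sum_seq {R : realType} d (T : measurableType d) (I : eqType)
    (s : seq I) (h : I -> T -> R) :
  {in s, forall i, measurable_fun setT (h i)} ->
  measurable_fun setT (fun x => \sum_(i <- s) h i x).
Proof.
elim: s => [_|i s IH hs].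
  by rewrite (_ : (fun x => _) = cst 0)//; apply/funext => x; rewrite big_nil.
rewrite (_ : (fun x => _) = (fun x => h i x + \sum_(k <- s) h k x)).
  apply: measurable_funD; first by apply: hs; rewrite inE eqxx.
  by apply: IH => k ks; apply: hs; rewrite inE ks orbT.
by apply/funext => x; rewrite big_cons.
Qed.

(** * Linear combinations of independent normal variables *)

Section normal_sums.
Local Open Scope ereal_scope.
Context {R : realType} d (T : measurableType d) (P : probability T R).
Implicit Types (s t : R) (Y : T -> R).
Local Notation gauss := (@normal_prob R 0 1).

(* [Y] is distributed as [s] times a standard normal variable; unlike
   [normal_prob 0 s], this is also the right notion for [s = 0]. *)
Definition scaled_normal Y s := measurable_fun setT Y /\
  forall A, measurable A -> P (Y @^-1` A) = gauss (( *%R s) @^-1` A).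

Lemma scaled_normal_integral Y s (g : R -> \bar R) : scaled_normal Y s ->
  measurable_fun [set: measurableTypeR R] g -> (forall x, 0 <= g x) ->
  \int[P]_w g (Y w) = \int[gauss]_x g (s * x)%R.
Proof.
move=> [mY YE] mg g0.
pose s_mul : measurableTypeR R -> measurableTypeR R := *%R s.
have ms : measurable_fun setT s_mul by exact: measurable_funM.
have mY' : measurable_fun setT (Y : T -> measurableTypeR R) by [].
pose Ym : {mfun T >-> measurableTypeR R} :=
  HB.pack (Y : T -> measurableTypeR R) (isMeasurableFun.Build _ _ _ _ _ mY').
pose sm : {mfun measurableTypeR R >-> measurableTypeR R} :=
  HB.pack s_mul (isMeasurableFun.Build _ _ _ _ _ ms).
transitivity (\int[distribution P Ym]_x g x).
  by rewrite ge0_integral_distribution.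
transitivity (\int[distribution (gauss : probability _ R) sm]_x g x).
  by apply: eq_measure_integral => A mA _; exact: YE.
by rewrite ge0_integral_distribution.
Qed.

Lemma scaled_normal_mgf_sqr Y s t : scaled_normal Y s -> (t * s ^+ 2 < 2^-1)%R ->
  \int[P]_w (expR (t * Y w ^+ 2))%:E = (Num.sqrt (1 - 2 * (t * s ^+ 2)))^-1%:E.
Proof.
move=> hY ts.
rewrite (@scaled_normal_integral _ _ (fun x => (expR (t * x ^+ 2))%:E) hY).
- rewrite -std_normal_mgf_sqr//; apply: eq_integral => x _.
  by rewrite exprMn mulrA.
- apply/measurable_EFinP; apply: measurableT_comp => //.
  by apply: measurable_funM => //; exact: measurable_funX.
- by move=> x; rewrite lee_fin expR_ge0.
Qed.

Context (I : finType) (X : I -> T -> R).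
Hypothesis hX : forall i, std_normal_rv P (X i).
Hypothesis indepX : mutually_independent P X.

(** Induction on [r]: the new term is decoupled from the partial sum [U], and [std_normal_conv] adds
    the variances. *)
Lemma scaled_normal_sum (r : seq I) (a : I -> R) : uniq r ->
  scaled_normal (fun w => \sum_(i <- r) a i * X i w)%R
    (Num.sqrt (\sum_(i <- r) a i ^+ 2)).
Proof.
have mX i : measurable_fun setT (X i) by have [] := hX i.
move=> ur; split.
  by apply: measurable_sum => i; apply: measurable_funM.
elim: r ur => [_ A mA|i r IH /= /andP[ir ur] A mA].
  rewrite big_nil sqrtr0.
  have [A0|nA0] := pselect (A 0%R).
    rewrite (_ : _ @^-1` A = setT); last first.
      by apply/seteqP; split => // w _ /=; rewrite big_nil.
    rewrite [X in gauss X](_ : _ = setT) ?probability_setT//.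
    by apply/seteqP; split => // w _ /=; rewrite mul0r.
  rewrite (_ : _ @^-1` A = set0); last first.
    by apply/seteqP; split => // w /=; rewrite big_nil.
  rewrite [X in gauss X](_ : _ = set0) ?measure0//.
  by apply/seteqP; split => // w /=; rewrite mul0r.
set U := (fun w => \sum_(k <- r) a k * X k w)%R.
rewrite big_cons; set s2 := (\sum_(k <- r) a k ^+ 2)%R.
have s20 : (0 <= s2)%R by apply: sumr_ge0 => k _; exact: sqr_ge0.
have -> : (fun w => \sum_(k <- i :: r) a k * X k w)%R @^-1` A =
    (fun w => U w + a i * X i w)%R @^-1` A.
  by apply/seteqP; split => w /=; rewrite big_cons addrC.
(* [std_normal_conv] requires a nonzero coefficient, so a vanishing [a i] is dropped first. *)
have [->|ai0] := eqVneq (a i) 0%R.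
  rewrite expr0n add0r -IH//; congr (P _).
  by apply/seteqP; split => w /=; rewrite mul0r addr0.
(* The conditional probability of the event when the partial sum equals [u]. *)
pose g (u : measurableTypeR R) : \bar R := gauss ((fun y => u + a i * y)%R @^-1` A).
have mpre (h : measurableTypeR R -> measurableTypeR R) :
    measurable_fun setT h -> measurable (h @^-1` A).
  by move=> mh; rewrite -[X in measurable X]setTI; exact: mh.
have mg : measurable_fun setT g.
  have := @measurable_fun_fubini_tonelli_F _ _ _ _ R gauss
    (fun p : measurableTypeR R * measurableTypeR R =>
       (\1_A (p.1 + a i * p.2)%R)%:E).
  rewrite /fubini_F => h.
  rewrite (_ : g = fun x => \int[gauss]_y (\1_A (x + a i * y)%R)%:E).
    apply: h => [|p]; last by rewrite lee_fin.
    apply/measurable_EFinP; apply: measurableT_comp.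
      exact: measurable_indic.
    apply: measurable_funD; first exact: measurable_fst.
    by apply: measurable_funM => //; exact: measurable_snd.
  apply/funext => u; rewrite /g.
  have mB : measurable ((fun y => u + a i * y)%R @^-1` A).
    by apply: mpre; apply: measurable_funD => //; exact: measurable_funM.
  by rewrite -[X in gauss X]setIT -integral_indic.
have mU : measurable_fun setT U.
  by apply: measurable_sum => k; apply: measurable_funM.
have mY : measurable ((fun w => U w + a i * X i w)%R @^-1` A).
  rewrite -[X in measurable X]setTI.
  have h : measurable_fun setT (fun w => U w + a i * X i w)%R.
    by apply: measurable_funD => //; exact: measurable_funM.
  exact: h.
have hU : scaled_normal U (Num.sqrt s2) by split => // B mB; exact: IH.
transitivity (\int[P]_w g (U w)); last first.
  rewrite (scaled_normal_integral hU)//.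
  rewrite /g (@std_normal_conv _ _ _ (Num.sqrt (a i ^+ 2 + s2)))//.
  by rewrite !sqr_sqrtr// 1?addrC// addr_ge0// sqr_ge0.
rewrite -[X in P X]setIT -integral_indic//.
rewrite (@ge0_integral_decouple _ _ _ P _ X mX indepX [set k in r]%SET [set i]%SET
  (fun w w' => (\1_A (U w + a i * X i w')%R)%:E))//; last 2 first.
- by rewrite disjoint_sym disjoints1 inE.
- apply/measurable_EFinP; apply: measurableT_comp; first exact: measurable_indic.
  apply: measurable_funD.
    apply: measurableT_comp measurable_fst.
    apply: measurable_sum_seq => k kr; apply: measurable_funM => //.
    by apply: measurable_block_entry; rewrite inE.
  apply: measurable_funM => //; apply: measurableT_comp measurable_snd.
  by apply: measurable_block_entry; rewrite inE.
apply: eq_integral => w _; rewrite /g.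
have mB : measurable ((fun y => U w + a i * y)%R @^-1` A).
  by apply: mpre; apply: measurable_funD => //; exact: measurable_funM.
have mXB : measurable (X i @^-1` ((fun y => U w + a i * y)%R @^-1` A)).
  by rewrite -[X in measurable X]setTI; exact: mX.
have [_ <-//] := hX i.
by rewrite -[X in P X]setIT -integral_indic.
Qed.

End normal_sums.

(** * The Chernoff factor for squared norms *)

Section chernoff_rate.
Context {R : realType}.
Implicit Types sg e : R.

(** The contribution of one coordinate with exponent [sg * e / 8]: the moment generating function of
    a squared standard normal variable, times the exponential for the threshold [1 + sg * e]. The
    exponent is convenient rather than optimal. *)
Definition chernoff_rate sg e : R :=
  expR (- (sg * e / 8 * (1 + sg * e))) * (Num.sqrt (1 - 2 * (sg * e / 8)))^-1.

Lemma chernoff_rate_ge0 sg e : 0 <= chernoff_rate sg e.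
Proof. by rewrite mulr_ge0 ?expR_ge0// invr_ge0 sqrtr_ge0. Qed.

(** After squaring, with [u = sg * e / 4], the claim reads [expR (- (u + e ^+ 2 / 4)) < 1 - u]. By
    [1 + x <= expR x] it suffices that [1 < (1 - u) * (1 + u + e ^+ 2 / 4)], which follows from
    [u ^+ 2 = e ^+ 2 / 16] and [u <= 1 / 4]. *)
Lemma chernoff_rate_lt1 sg e : sg ^+ 2 = 1 -> 0 < e -> e <= 1 ->
  chernoff_rate sg e < 1.
Proof.
move=> sg2 e0 e1; set u := sg * e / 4.
have u2 : u ^+ 2 = e ^+ 2 / 16 by rewrite /u !exprMn sg2; field.
have uu : u <= 1 / 4.
  rewrite leNgt; apply/negP => u4.
  have : 0 < (u - 1 / 4) * (u + 1 / 4) by apply: mulr_gt0; lra.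
  have : 0 <= (1 - e) * (1 + e) by apply: mulr_ge0; lra.
  by lra.
suff : chernoff_rate sg e ^+ 2 < 1.
  by move=> h; rewrite -(ltr_pXn2r (n := 2)) ?expr1n// ?nnegrE ?chernoff_rate_ge0.
have u1 : 0 < 1 - u by lra.
rewrite exprMn exprVn sqr_sqrtr; last by rewrite /u in u1; lra.
rewrite -expRM_natr (_ : 1 - 2 * (sg * e / 8) = 1 - u); last by rewrite /u; field.
rewrite ltr_pdivrMr// mul1r.
rewrite (_ : _ * 2 = - (u + e ^+ 2 / 4)); last first.
  rewrite /u [LHS](_ : _ = - (sg * e / 4 + sg ^+ 2 * e ^+ 2 / 4)); last by field.
  by rewrite sg2 mul1r.
rewrite expRN invf_plt ?posrE ?expR_gt0//.
apply: lt_le_trans (expR_ge1Dx _).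
rewrite -[ltLHS]mul1r ltr_pdivrMr//.
have e2 : 0 < e ^+ 2 by rewrite exprn_gt0.
have : 0 < e ^+ 2 * (1 / 4 - u) + e ^+ 2 by nra.
by nra.
Qed.

End chernoff_rate.

(** * Combinations of the rows of a Gaussian matrix and their squared norms *)

Section gaussian_matrix.
Local Open Scope ereal_scope.
Context {R : realType} d (T : measurableType d) (P : probability T R).
Context (m n : nat) (W : 'I_m * 'I_n -> T -> R).
Hypothesis hW : forall ij, std_normal_rv P (W ij).
Hypothesis indepW : mutually_independent P W.
Implicit Types (a : 'I_m -> R) (v : 'I_n -> R).
Local Notation gauss := (@normal_prob R 0 1).

(** With [w_i] the rows, [col_comb a] is the vector of coordinates of the combination of the [w_i]
    with weights [a i], and [row_comb v i] is the scalar product [w_i . v]. *)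
Definition col_comb a (j : 'I_n) (w : T) : R := (\sum_i a i * W (i, j) w)%R.
Definition row_comb v (i : 'I_m) (w : T) : R := (\sum_j v j * W (i, j) w)%R.
Definition comb_sqnorm a (w : T) : R := (\sum_j col_comb a j w ^+ 2)%R.

Let mW ij : measurable_fun setT (W ij). Proof. by have [] := hW ij. Qed.

Lemma measurable_col_comb a j : measurable_fun setT (col_comb a j).
Proof. by apply: measurable_sum => i; exact: measurable_funM. Qed.

Lemma measurable_row_comb v i : measurable_fun setT (row_comb v i).
Proof. by apply: measurable_sum => j; exact: measurable_funM. Qed.

Lemma measurable_comb_sqnorm a : measurable_fun setT (comb_sqnorm a).
Proof.
by apply: measurable_sum => j; apply: measurable_funX; exact: measurable_col_comb.
Qed.

Lemma scaled_normal_col a j :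
  scaled_normal P (col_comb a j) (Num.sqrt (\sum_i a i ^+ 2)).
Proof.
pose r := [seq (i, j) | i <- index_enum 'I_m].
rewrite (_ : col_comb a j = fun w => \sum_(p <- r) a p.1 * W p w)%R; last first.
  by apply/funext => w; rewrite big_map.
rewrite (_ : \sum_i _ = \sum_(p <- r) a p.1 ^+ 2)%R; last by rewrite big_map.
apply: (scaled_normal_sum hW indepW (fun p => a p.1)).
by rewrite map_inj_uniq ?index_enum_uniq// => x y [].
Qed.

Lemma scaled_normal_row v i :
  scaled_normal P (row_comb v i) (Num.sqrt (\sum_j v j ^+ 2)).
Proof.
pose r := [seq (i, j) | j <- index_enum 'I_n].
rewrite (_ : row_comb v i = fun w => \sum_(p <- r) v p.2 * W p w)%R; last first.
  by apply/funext => w; rewrite big_map.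
rewrite (_ : \sum_j _ = \sum_(p <- r) v p.2 ^+ 2)%R; last by rewrite big_map.
apply: (scaled_normal_sum hW indepW (fun p => v p.2)).
by rewrite map_inj_uniq ?index_enum_uniq// => x y [].
Qed.

(** The coordinates of the combination use different columns of [W], so the integral factors into
    [n] equal ones. *)
Lemma comb_sqnorm_mgf a (t : R) : (t * \sum_i a i ^+ 2 < 2^-1)%R ->
  \int[P]_w (expR (t * comb_sqnorm a w))%:E =
  ((Num.sqrt (1 - 2 * (t * \sum_i a i ^+ 2)))^-1 ^+ n)%:E.
Proof.
move=> ht; have s0 : (0 <= \sum_i a i ^+ 2)%R.
  by apply: sumr_ge0 => i _; exact: sqr_ge0.
under eq_integral do rewrite mulr_sumr expR_sum.
pose J (j : 'I_n) : {set 'I_m * 'I_n} := [set p | p.2 == j]%SET.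
rewrite (@ge0_integral_prod_blocks _ _ _ P _ W mW indepW _ (index_enum 'I_n) J
  (fun j w => expR (t * col_comb a j w ^+ 2))).
- rewrite (eq_bigr (fun=> ((Num.sqrt (1 - 2 * (t * \sum_i a i ^+ 2)))^-1)%:E)).
    by rewrite prodEFin prodr_const card_ord.
  move=> j _; rewrite (scaled_normal_mgf_sqr (scaled_normal_col a j)) sqr_sqrtr//.
- exact: index_enum_uniq.
- move=> k l _ _ kl; rewrite -finset.setI_eq0; apply/eqP/finset.setP => p.
  by rewrite !inE; apply/negP => /andP[/eqP h]; rewrite h (negbTE kl).
- move=> j _; apply: measurableT_comp => //; apply: measurable_funM => //.
  apply: measurable_funX; apply: measurable_sum => i.
  by apply: measurable_funM => //; apply: measurable_block_entry; rewrite inE.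
- by move=> j w; exact: expR_ge0.
Qed.

(* [sg = 1] gives the upper tail and [sg = -1] the lower tail. *)
Lemma comb_sqnorm_concentration (sg e : R) a : (sg ^+ 2 = 1)%R ->
  (0 < e)%R -> (e <= 1)%R -> (0 < \sum_i a i ^+ 2)%R ->
  P [set w | sg * ((1 + sg * e) * n%:R * \sum_i a i ^+ 2) <=
             sg * comb_sqnorm a w]%R <= (chernoff_rate sg e ^+ n)%:E.
Proof.
set s := (\sum_i _)%R => sg2 e0 e1 s0.
set E := [set w | _]; set th := ((1 + sg * e) * n%:R * s)%R.
(* Dividing by the variance [s] normalizes the exponent: [t * s <= 1 / 8], within the range of
   [comb_sqnorm_mgf]. *)
pose t := (sg * e / 8 / s)%R.
have sge : (sg * e <= 1)%R.
  have : (sg ^+ 2 == 1 ^+ 2)%R by rewrite sg2 expr1n.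
  by rewrite eqf_sqr => /orP[] /eqP ->; lra.
have ts : (t * s = sg * e / 8)%R by rewrite /t divfK// gt_eqF.
have mE : measurable E.
  have h : measurable_fun setT (fun w => sg * comb_sqnorm a w)%R.
    by apply: measurable_funM => //; exact: measurable_comb_sqnorm.
  rewrite (_ : E = (fun w => sg * comb_sqnorm a w)%R @^-1` `[(sg * th)%R, +oo[).
    by rewrite -[X in measurable X]setTI; exact: h.
  by apply/seteqP; split => w /=; rewrite in_itv /= andbT.
have mexp : measurable_fun setT (fun w => (expR (t * comb_sqnorm a w))%:E).
  apply/measurable_EFinP; apply: measurableT_comp => //.
  by apply: measurable_funM => //; exact: measurable_comb_sqnorm.
(* Exponential Markov inequality; [t] has the sign of [sg], so the exponent is nonnegative on
   [E]. *)
apply: (@le_trans _ _ (\int[P]_w ((expR (- (t * th)))%:E *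
    (expR (t * comb_sqnorm a w))%:E))).
  rewrite -[X in P X]setIT -integral_indic//; apply: ge0_le_integral => //.
  - by apply/measurable_EFinP.
  - exact: emeasurable_funM.
  - move=> w _; rewrite -EFinM lee_fin -expRD indicE.
    case: (boolP (w \in E)) => [/set_mem /= hw|_]; last exact: expR_ge0.
    rewrite -[leLHS]expR0 ler_expR addrC subr_ge0.
    pose k := (e / (8 * s))%R.
    have k0 : (0 < k)%R by rewrite divr_gt0// mulr_gt0.
    have -> : (t = k * sg)%R by rewrite /t /k; field; rewrite gt_eqF.
    by rewrite -!(mulrA k) ler_pM2l.
rewrite ge0_integralZl//.
rewrite comb_sqnorm_mgf -/s ts; last by lra.
rewrite -EFinM lee_fin /chernoff_rate exprMn -expRM_natr.
rewrite (_ : (- (t * th) = - (sg * e / 8 * (1 + sg * e)) * n%:R)%R)//.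
by rewrite /th -ts; ring.
Qed.

End gaussian_matrix.

(** * Union bound and the conditional estimate for a fixed set of rows *)

Lemma probability_union_bound {R : realType} d (T : measurableType d)
    (P : probability T R) (L : eqType) (r : seq L) (A : L -> set T) (x : R) :
  {in r, forall l, measurable (A l)} -> {in r, forall l, (P (A l) <= x%:E)%E} ->
  measurable [set w | exists2 l, l \in r & A l w] /\
  (P [set w | exists2 l, l \in r & A l w] <= ((size r)%:R * x)%:E)%E.
Proof.
elim: r => [_ _|k r IH mA hA].
  rewrite (_ : [set w | _] = set0); last by apply/seteqP; split => w // [].
  by rewrite measure0 mul0r; split.
have [|//|mU hU] := IH _ _.
- by move=> l lr; apply: mA; rewrite inE lr orbT.
- by move=> l lr; apply: hA; rewrite inE lr orbT.
rewrite (_ : [set w | _] = A k `|` [set w | exists2 l, l \in r & A l w]).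
  have mk : measurable (A k) by apply: mA; rewrite mem_head.
  split; first exact: measurableU.
  apply: (le_trans (measureU2 _ _ _)) => //.
  rewrite /= -natr1 mulrDl mul1r addrC EFinD leeD//.
  by apply: hA; rewrite mem_head.
apply/seteqP; split => w /=.
  by move=> [l]; rewrite inE => /orP[/eqP ->|lr] Al; [left|right; exists l].
by move=> [Ak|[l lr Al]]; [exists k; rewrite ?mem_head|exists l; rewrite ?inE ?lr ?orbT].
Qed.

Section bad_rows.
Local Open Scope ereal_scope.
Context {R : realType} d (T : measurableType d) (P : probability T R).
Context (m n : nat) (W : 'I_m * 'I_n -> T -> R).
Hypothesis hW : forall ij, std_normal_rv P (W ij).
Hypothesis indepW : mutually_independent P W.
Implicit Types (B : {set 'I_m}).
Local Notation gauss := (@normal_prob R 0 1).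

Let mW ij : measurable_fun setT (W ij). Proof. by have [] := hW ij. Qed.

Definition inside B (i : 'I_m) : R := (i \in B)%:R.
Definition outside B (i : 'I_m) : R := (i \notin B)%:R.
(** The vector [V] of the opening comment; [U] is [col_comb] with the weights [inside B]. *)
Definition outer_sum B (w : T) (j : 'I_n) : R := col_comb W (outside B) j w.

Let oJ B : {set 'I_m * 'I_n} := [set p | p.1 \notin B]%SET.
Let oK B : {set 'I_m * 'I_n} := [set p | p.1 \in B]%SET.

Lemma measurable_outer_sum B j : measurable_fun setT
  ((fun w => outer_sum B w j) : g_sigma_algebraType (cylinders W (oJ B)) -> R).
Proof.
apply: measurable_sum => i; rewrite /outside.
case: (boolP (i \in B)) => iB /=.
  by rewrite (_ : (fun w => _) = cst 0%R)//; apply/funext => w; rewrite mul0r.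
apply: measurable_funM => //; apply: measurable_block_entry.
by rewrite inE.
Qed.

(** From [s * x <= - th] follows [x < 0], then [Num.sqrt M * x <= s * x <= - th <= - z * Num.sqrt
    M]. The degenerate case [s = 0] causes no harm, as [0 < th] makes the event empty. *)
Lemma scaled_normal_tail_le (Y : T -> R) (s M th z : R) : scaled_normal P Y s ->
  (0 <= s)%R -> (s <= Num.sqrt M)%R -> (0 < th)%R -> (z * Num.sqrt M <= th)%R ->
  P (Y @^-1` `]-oo, (- th)%R]) <= gauss `]-oo, (- z)%R].
Proof.
move=> [mY YE] s0 sM th0 zM; rewrite YE//; apply: le_measure; rewrite ?inE//.
  have ms : measurable_fun setT ( *%R s : measurableTypeR R -> measurableTypeR R).
    exact: measurable_funM.
  by rewrite -[X in measurable X]setTI; exact: ms.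
move=> x /=; rewrite !in_itv /= => sx.
have x0 : (x < 0)%R by rewrite ltNge; apply/negP => x0; nra.
have M0 : (0 < Num.sqrt M)%R.
  rewrite lt_neqAle sqrtr_ge0 andbT; apply/negP => /eqP M0.
  have s00 : (s = 0)%R by lra.
  by rewrite s00 in sx; lra.
by rewrite -(ler_pM2r M0) mulNr; nra.
Qed.

Lemma measurable_rows_event B (th M : R) :
  measurable [set w | comb_sqnorm W (outside B) w <= M /\
     forall i, i \in B -> row_comb W (outer_sum B w) i w <= - th]%R.
Proof.
have mo j : measurable_fun setT (fun w => outer_sum B w j).
  by apply: measurable_sum => i; exact: measurable_funM.
have mr i : measurable_fun setT (fun w => row_comb W (outer_sum B w) i w).
  by apply: measurable_sum => j; exact: measurable_funM.
rewrite (_ : [set w | _] = comb_sqnorm W (outside B) @^-1` `]-oo, M] `&`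
   \bigcap_(i in [set i | i \in B])
     ((fun w => row_comb W (outer_sum B w) i w) @^-1` `]-oo, (- th)%R])).
  apply: measurableI.
    rewrite -[X in measurable X]setTI.
    exact: (measurable_comb_sqnorm hW).
  apply: fin_bigcap_measurable => // i _.
  by rewrite -[X in measurable X]setTI; exact: mr.
apply/seteqP; split => w /=.
  move=> [h1 h2]; split; first by rewrite in_itv.
  by move=> i /= iB; rewrite in_itv /=; exact: h2.
by rewrite in_itv /= => -[h1 h2]; split => // i iB;
  have := h2 i iB; rewrite /= in_itv.
Qed.

(** Freezing the rows outside [B] fixes [V]; the scalar products of [V] with the rows in [B] are
    then independent, and each tail is at most [p]. *)
Lemma rows_conditional_bound B (th M z p : R) :
  gauss `]-oo, (- z)%R] = p%:E -> (0 < th)%R -> (z * Num.sqrt M <= th)%R ->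
  P [set w | comb_sqnorm W (outside B) w <= M /\
     forall i, i \in B -> row_comb W (outer_sum B w) i w <= - th]%R
  <= (p ^+ #|B|)%:E.
Proof.
move=> pE th0 zM.
have p0 : (0 <= p)%R by rewrite -lee_fin -pE.
(* The indicator of the event with the sample point split in two: [w] feeds the rows outside [B],
   [w'] the rows in [B]. *)
pose F (w w' : T) : \bar R :=
  (\1_(`]-oo, M]) (\sum_j outer_sum B w j ^+ 2) *
   \prod_(i <- enum B) \1_(`]-oo, (- th)%R])
      (\sum_j outer_sum B w j * W (i, j) w'))%R%:E.
have F0 w w' : 0 <= F w w'.
  by rewrite lee_fin mulr_ge0//; apply: prodr_ge0.
set E := [set w | _].
have JK : [disjoint oJ B & oK B]%B.
  rewrite -finset.setI_eq0; apply/eqP/finset.setP => q.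
  by rewrite !inE; case: (_ \in _).
have EE : (fun w => (\1_E w)%:E) = (fun w => F w w).
  apply/funext => w; rewrite /F; congr EFin; rewrite indicE.
  case: (boolP (w \in E)) => [/set_mem[h1 h2]|/negP nE].
    rewrite indicE mem_set ?mul1r; last by rewrite /= in_itv.
    rewrite big_seq big1// => i; rewrite mem_enum => iB.
    by rewrite indicE mem_set//= in_itv /=; exact: h2.
  have [h1|h1] := leP (comb_sqnorm W (outside B) w) M; last first.
    by rewrite indicE memNset ?mul0r// /= in_itv /=; apply/negP; rewrite -ltNge.
  have /existsNP[i /not_implyP[iB /negP]] :
      ~ forall i, i \in B -> (row_comb W (outer_sum B w) i w <= - th)%R.
    by move=> h; apply: nE; apply/mem_set; split.
  move=> hi; rewrite (bigD1_seq i) ?mem_enum ?enum_uniq//=.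
  have -> : (\1_(`]-oo, (- th)%R]) (\sum_j outer_sum B w j * W (i, j) w)%R =
      0 :> R)%R.
    by rewrite indicE memNset//= in_itv /=; exact/negP.
  by rewrite mul0r mulr0.
have mF : measurable_fun [set: g_sigma_algebraType (cylinders W (oJ B)) *
    g_sigma_algebraType (cylinders W (oK B))] (fun p => F p.1 p.2).
  have mo j := measurableT_comp (@measurable_outer_sum B j)
    (@measurable_fst _ _ (g_sigma_algebraType (cylinders W (oJ B)))
      (g_sigma_algebraType (cylinders W (oK B)))).
  apply/measurable_EFinP; apply: measurable_funM.
    apply: measurableT_comp; first exact: measurable_indic.
    apply: measurable_sum => j; apply: measurable_funX.
    exact: mo.
  apply: measurable_prod => i; rewrite mem_enum => iB.
  apply: measurableT_comp; first exact: measurable_indic.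
  apply: measurable_sum => j; apply: measurable_funM.
    exact: mo.
  apply: measurableT_comp measurable_snd; apply: measurable_block_entry.
  by rewrite inE.
have mE : measurable E by exact: measurable_rows_event.
rewrite -[X in P X]setIT -integral_indic// EE.
apply: (ge0_integral_decouple_le mW indepW JK mF F0) => w.
rewrite /F; under eq_integral do rewrite EFinM.
have mrow i : measurable_fun setT (row_comb W (outer_sum B w) i).
  exact: (measurable_row_comb hW).
rewrite ge0_integralZl//; last 2 first.
- apply/measurable_EFinP; apply: measurable_prod => i _.
  apply: measurableT_comp; first exact: measurable_indic.
  exact: mrow.
- by move=> w' _; rewrite lee_fin; apply: prodr_ge0.
rewrite (@ge0_integral_prod_blocks _ _ _ P _ W mW indepW _ (enum B)
  (fun i => [set q | q.1 == i]%SET)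
  (fun i w' => \1_(`]-oo, (- th)%R]) (\sum_j outer_sum B w j * W (i, j) w')%R));
    last 4 first.
- exact: enum_uniq.
- move=> k l _ _ kl; rewrite -finset.setI_eq0; apply/eqP/finset.setP => q.
  by rewrite !inE; apply/negP => /andP[/eqP h]; rewrite h (negbTE kl).
- move=> i _; apply: measurableT_comp; first exact: measurable_indic.
  apply: measurable_sum => j; apply: measurable_funM => //.
  by apply: measurable_block_entry; rewrite inE.
- by move=> i w'.
rewrite indicE; case: (boolP (_ \in _)) => [/set_mem|_]; last first.
  by rewrite mul0e lee_fin exprn_ge0.
rewrite /= in_itv /= mul1e => hM.
rewrite cardE; elim: (enum B) => [|i r IH]; first by rewrite big_nil expr0.
rewrite big_cons exprS EFinM; apply: lee_pmul => //.
- by apply: integral_ge0 => w' _; rewrite lee_fin.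
- by apply: prode_ge0 => l _; apply: integral_ge0 => w' _; rewrite lee_fin.
have mA : measurable (row_comb W (outer_sum B w) i @^-1` `]-oo, (- th)%R]).
  by rewrite -[X in measurable X]setTI; exact: mrow.
rewrite -pE.
apply: le_trans (scaled_normal_tail_le
  (scaled_normal_row hW indepW (outer_sum B w) i) _ _ th0 zM).
- by rewrite -[X in _ <= P X]setIT -integral_indic.
- exact: sqrtr_ge0.
- by rewrite ler_wsqrtr.
Qed.

End bad_rows.

(** * The probability that all rows of a given set are bad *)

Section all_bad.
Local Open Scope ereal_scope.
Context {R : realType} d (T : measurableType d) (P : probability T R).
Context (m n : nat) (W : 'I_m * 'I_n -> T -> R).
Implicit Types (B : {set 'I_m}) (a : 'I_m -> R).
Local Notation gauss := (@normal_prob R 0 1).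

Definition total_sum (w : T) (j : 'I_n) : R := col_comb W (fun=> 1%R) j w.
Definition all_bad B : set T :=
  [set w | forall i, i \in B -> (row_comb W (total_sum w) i w <= 0)%R].

Definition delta (i k : 'I_m) : R := (k == i)%:R.

Lemma col_comb_delta i j w : col_comb W (delta i) j w = W (i, j) w.
Proof.
rewrite /col_comb (bigD1 i)//= /delta eqxx mul1r big1 ?addr0// => k /negbTE ->.
by rewrite mul0r.
Qed.

Lemma col_combD a b j w :
  col_comb W (fun k => a k + b k)%R j w = (col_comb W a j w + col_comb W b j w)%R.
Proof. by rewrite -big_split; apply: eq_bigr => i _; rewrite /= mulrDl. Qed.

(** Polarization reduces scalar products to squared norms, to which [comb_sqnorm_concentration]
    applies. *)
Lemma row_comb_polarization a i w :
  row_comb W (fun j => col_comb W a j w) i w =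
  ((comb_sqnorm W (fun k => a k + delta i k)%R w - comb_sqnorm W a w -
    comb_sqnorm W (delta i) w) / 2)%R.
Proof.
rewrite /comb_sqnorm -!sumrB mulr_suml; apply: eq_bigr => j _.
by rewrite col_combD col_comb_delta; field.
Qed.

Lemma row_comb_total B i w : row_comb W (total_sum w) i w =
  (row_comb W (fun j => col_comb W (inside B) j w) i w +
   row_comb W (outer_sum W B w) i w)%R.
Proof.
rewrite -big_split; apply: eq_bigr => j _ /=; rewrite -mulrDl; congr (_ * _)%R.
rewrite -col_combD; apply: eq_bigr => k _; congr (_ * _)%R.
by rewrite /inside /outside; case: (k \in B); rewrite /= ?addr0 ?add0r.
Qed.

Lemma sum_sqr_inside B : (\sum_k (@inside R m B k) ^+ 2 = #|B|%:R)%R.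
Proof.
rewrite (eq_bigr (fun k => (k \in B)%:R)%R).
  by rewrite -natr_sum -sum1_card [in RHS]big_mkcond.
by move=> k _; rewrite /inside; case: (k \in B); rewrite ?expr1n ?expr0n.
Qed.

Lemma sum_sqr_outside B : (\sum_k (@outside R m B k) ^+ 2 = (m - #|B|)%:R)%R.
Proof.
have <- : #|(~: B)%SET| = (m - #|B|)%N by rewrite cardsCs finset.setCK card_ord.
by rewrite -sum_sqr_inside; apply: eq_bigr => k _; rewrite /outside /inside inE.
Qed.

Lemma sum_sqr_delta i : (\sum_k (delta i k) ^+ 2 = 1)%R.
Proof.
rewrite (bigD1 i)//= /delta eqxx expr1n big1 ?addr0// => k /negbTE ->.
by rewrite expr0n.
Qed.

(** Row [i] has coefficient [2] and contributes [4] in place of [1]. *)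
Lemma sum_sqr_insideD B i : i \in B ->
  (\sum_k (inside B k + delta i k) ^+ 2 = #|B|%:R + 3)%R.
Proof.
move=> iB.
rewrite (eq_bigr (fun k => inside B k ^+ 2 + 3 * delta i k ^+ 2)%R); last first.
  move=> k _; rewrite /delta; case: eqP => [->|_].
    by rewrite /inside iB /=; ring.
  by rewrite /= mulr0n; ring.
by rewrite big_split /= -mulr_sumr sum_sqr_inside sum_sqr_delta mulr1.
Qed.

Hypothesis hW : forall ij, std_normal_rv P (W ij).
Hypothesis indepW : mutually_independent P W.

Lemma measurable_all_bad B : measurable (all_bad B).
Proof.
have mW ij : measurable_fun setT (W ij) by have [] := hW ij.
have mr i : measurable_fun setT (fun w => row_comb W (total_sum w) i w).
  apply: measurable_sum => j; apply: measurable_funM => //.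
  exact: (measurable_col_comb hW).
rewrite (_ : all_bad B = \bigcap_(i in [set i | i \in B])
  ((fun w => row_comb W (total_sum w) i w) @^-1` `]-oo, 0%R])).
  apply: fin_bigcap_measurable => // i _.
  by rewrite -[X in measurable X]setTI; exact: mr.
by apply/seteqP; split => w /= h i iB; have := h i iB; rewrite /= in_itv.
Qed.

Lemma measurable_comb_sqnorm_ge (sg x : R) a :
  measurable [set w | x <= sg * comb_sqnorm W a w]%R.
Proof.
have h : measurable_fun setT (fun w => sg * comb_sqnorm W a w)%R.
  by apply: measurable_funM => //; exact: (measurable_comb_sqnorm hW).
rewrite (_ : [set w | _] = (fun w => sg * comb_sqnorm W a w)%R @^-1` `[x, +oo[).
  by rewrite -[X in measurable X]setTI; exact: h.
by apply/seteqP; split => w /=; rewrite in_itv /= andbT.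
Qed.

(** The exceptional events are upper deviations of the squared norms of [V], of [U] and of the [k]
    rows in [B], hence the factor [k%:R + 2], and lower deviations of the [k] vectors [U + w_i]. Off
    these events [rows_conditional_bound] applies. *)
Lemma all_bad_bound B (e z p : R) (k := #|B|) : gauss `]-oo, (- z)%R] = p%:E ->
  (0 < e)%R -> (e * (k%:R + 2) < 1)%R -> (0 < n)%N -> (0 < k)%N -> (k < m)%N ->
  (z * Num.sqrt ((1 + e) * n%:R * (m - k)%:R) <= n%:R * (1 - e * (k%:R + 2)))%R ->
  P (all_bad B) <= (p ^+ k + (k%:R + 2) * chernoff_rate 1 e ^+ n +
                    k%:R * chernoff_rate (-1) e ^+ n)%:E.
Proof.
move=> pE e0 ek n0 k0 km hz.
have kR : (1 <= k%:R :> R)%R by rewrite ler1n.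
have e1 : (e <= 1)%R by nra.
have nR : (0 < n%:R :> R)%R by rewrite ltr0n.
pose Q (sg : R) a : set T := [set w | sg * ((1 + sg * e) * n%:R * \sum_i a i ^+ 2)
  <= sg * comb_sqnorm W a w]%R.
have mQ sg a : measurable (Q sg a) by exact: measurable_comb_sqnorm_ge.
have PQ (sg : R) a : (sg ^+ 2 = 1)%R -> (0 < \sum_i a i ^+ 2)%R ->
    P (Q sg a) <= (chernoff_rate sg e ^+ n)%:E.
  by move=> sg2 a0; exact: comb_sqnorm_concentration.
pose th := (n%:R * (1 - e * (k%:R + 2)))%R.
pose M := ((1 + e) * n%:R * (m - k)%:R)%R.
set E0 := [set w | comb_sqnorm W (outside B) w <= M /\
     forall i, i \in B -> row_comb W (outer_sum W B w) i w <= - th]%R.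
have E0b : P E0 <= (p ^+ k)%:E.
  have th0 : (0 < th)%R by rewrite /th mulr_gt0//; lra.
  exact: (rows_conditional_bound hW indepW B pE th0 hz).
have [mU1 PU1] := @probability_union_bound _ _ _ P _ (enum B)
  (fun i => Q 1%R (delta i)) (chernoff_rate 1 e ^+ n)%R
  (fun i _ => mQ 1%R (delta i))
  (fun i _ => PQ 1%R (delta i) (expr1n _ _)
     (eq_ind_r (fun x => 0 < x)%R ltr01 (sum_sqr_delta i))).
have [|mU2 PU2] := @probability_union_bound _ _ _ P _ (enum B)
  (fun i => Q (-1)%R (fun l => inside B l + delta i l)%R)
  (chernoff_rate (-1) e ^+ n)%R
  (fun i _ => mQ (-1)%R (fun l => inside B l + delta i l)%R).
  move=> i; rewrite mem_enum => iB; apply: PQ; first by rewrite sqrrN expr1n.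
  by rewrite sum_sqr_insideD//; lra.
set U1 := [set w | exists2 l, l \in enum B & Q 1%R _ w] in mU1 PU1.
set U2 := [set w | exists2 l, l \in enum B & Q (-1)%R _ w] in mU2 PU2.
have cover : all_bad B `<=`
    E0 `|` (Q 1%R (outside B) `|` (Q 1%R (inside B) `|` (U1 `|` U2))).
  move=> w bw.
  have [|nQ1] := pselect (Q 1%R (outside B) w); first by right; left.
  have [|nQ2] := pselect (Q 1%R (inside B) w); first by right; right; left.
  have [|nU1] := pselect (U1 w); first by right; right; right; left.
  have [|nU2] := pselect (U2 w); first by right; right; right; right.
  left; split.
    move: nQ1; rewrite /Q /= !mul1r sum_sqr_outside => /negP.
    by rewrite -ltNge => /ltW.
  move=> i iB; have := bw i iB; rewrite (row_comb_total B) row_comb_polarization.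
  move: nQ2; rewrite /Q /= !mul1r sum_sqr_inside => /negP; rewrite -ltNge => h2.
  have h3 : (comb_sqnorm W (delta i) w < (1 + e) * n%:R)%R.
    rewrite ltNge; apply/negP => h3; apply: nU1; exists i; rewrite ?mem_enum//.
    by rewrite /Q /= !mul1r sum_sqr_delta mulr1.
  have h4 : ((1 - e) * n%:R * (k%:R + 3) <
      comb_sqnorm W (fun l => inside B l + delta i l) w)%R.
    rewrite ltNge; apply/negP => h4; apply: nU2; exists i; rewrite ?mem_enum//.
    by rewrite /Q /= sum_sqr_insideD// !mulN1r lerN2.
  (* Polarization gives [w_i . U] at least [n / 2] times [(1 - e) * (k + 3) - (1 + e) * k - (1 +
     e)], which is [th]; badness then forces [w_i . V <= - th]. *)
  rewrite /th -/k in h2 *; nra.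
have mE0 : measurable E0.
  exact: (measurable_rows_event hW).
apply: (le_trans (le_measure P _ _ cover)); rewrite ?inE.
- exact: measurable_all_bad.
- by do !apply: measurableU.
apply: (le_trans (measureU2 _ _ _)) => //; first by do !apply: measurableU.
rewrite (_ : (_ + _ + _ = p ^+ k + (chernoff_rate 1 e ^+ n +
  (chernoff_rate 1 e ^+ n + (k%:R * chernoff_rate 1 e ^+ n +
     k%:R * chernoff_rate (-1) e ^+ n))))%R); last by ring.
rewrite EFinD leeD//.
apply: (le_trans (measureU2 _ _ _)) => //; first by do !apply: measurableU.
rewrite EFinD leeD//.
  (* Concentration needs a nonzero weight vector; here [k < m] provides a row outside [B]. *)
  apply: PQ; first by rewrite expr1n.
  by rewrite sum_sqr_outside ltr0n subn_gt0.
apply: (le_trans (measureU2 _ _ _)) => //; first by do !apply: measurableU.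
rewrite EFinD leeD//.
  apply: PQ; first by rewrite expr1n.
  by rewrite sum_sqr_inside ltr0n.
apply: (le_trans (measureU2 _ _ _)) => //.
by rewrite EFinD /k cardE leeD.
Qed.

End all_bad.

(** * A deterministic criterion for non-injectivity *)

Section ReLU_kernel.
Context {R : realType}.

Lemma exists_small_scale (I : finType) (A : {set I}) (b c : I -> R) :
  {in A, forall i, 0 < b i} ->
  exists2 t, 0 < t & {in A, forall i, t * c i <= b i}.
Proof.
(* [S] dominates every ratio [c i / b i], so the step [S^-1] serves all indices; the summand [1]
   keeps [S] positive even if the sum vanishes. *)
move=> b0; pose S := 1 + \sum_(i in A) `|c i| / b i.
have pos : 0 <= \sum_(i in A) `|c i| / b i.
  by apply: sumr_ge0 => i iA; rewrite divr_ge0// ltW// b0.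
have S0 : 0 < S by rewrite ltr_pwDl.
exists S^-1; rewrite ?invr_gt0// => i iA.
rewrite mulrC ler_pdivrMr// mulrC -ler_pdivrMr ?b0//.
apply: (@le_trans _ _ (`|c i| / b i)).
  by rewrite ler_wpM2r ?ler_norm// invr_ge0 ltW// b0.
rewrite /S (bigD1 i)//= addrA ler_wpDr ?ler_wpDl//.
by apply: sumr_ge0 => k /andP[kA _]; rewrite divr_ge0// ltW// b0.
Qed.

(* Moving [x] along the kernel of the rows with nonnegative output keeps those
   outputs, and the other outputs stay negative for a small enough step. *)
Lemma ReLU_not_injective (m n : nat) (M : 'M[R]_(m, n)) (x : 'cV[R]_n) :
  (#|[set i | (0 <= (M *m x) i ord0)%R]%SET| < n)%N ->
  ~ injective (fun y : 'cV[R]_n => ReLU (M *m y)).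
Proof.
set N := [set i | _]%SET => Nn inj.
pose A : 'M[R]_(#|N|, n) := rowsub (fun k : 'I_#|N| => enum_val k) M.
(* [kermx] is a left kernel, hence the transpose; the rank of [A] is at most [#|N|], which is less
   than [n]. *)
have ker0 : kermx A^T != 0.
  rewrite -mxrank_eq0 mxrank_ker mxrank_tr -lt0n subn_gt0.
  exact: leq_ltn_trans (rank_leq_row A) Nn.
pose u := (nz_row (kermx A^T))^T.
have u0 : u != 0 by rewrite /u -trmx0 (inj_eq trmx_inj) nz_row_eq0.
have Au : A *m u = 0.
  apply: trmx_inj; rewrite trmx_mul trmx0 trmxK.
  by apply/sub_kermxP; exact: nz_row_sub.
have MuN i : i \in N -> (M *m u) i ord0 = 0.
  move=> iN; have := congr1 (fun B : 'cV[R]__ => B (enum_rank_in iN i) ord0) Au.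
  rewrite !mxE => h; rewrite -[RHS]h; apply: eq_bigr => j _.
  by rewrite !mxE enum_rankK_in.
have neg i : i \in (~: N)%SET -> 0 < - (M *m x) i ord0.
  by rewrite !inE -ltNge oppr_gt0.
have [t t0 ht] := @exists_small_scale _ (~: N)%SET _
  (fun i => (M *m u) i ord0) neg.
have : x + t *: u = x.
  apply: inj; apply/matrixP => i j; rewrite (ord1 j) !mxE.
  have -> : \sum_j0 M i j0 * (x + t *: u) j0 ord0 =
      (M *m x) i ord0 + t * (M *m u) i ord0.
    rewrite !mxE mulr_sumr -big_split /=; apply: eq_bigr => l _.
    by rewrite !mxE; ring.
  have -> : \sum_j0 M i j0 * x j0 ord0 = (M *m x) i ord0 by rewrite mxE.
  case: (boolP (i \in N)) => iN; first by rewrite MuN// mulr0 addr0.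
  have iN' : i \in (~: N)%SET by rewrite inE.
  have h1 := neg _ iN'; have h2 := ht _ iN'.
  by rewrite !max_r//; lra.
move/eqP; rewrite -subr_eq0 addrAC subrr add0r scaler_eq0 (gt_eqF t0) /=.
by rewrite (negbTE u0).
Qed.

End ReLU_kernel.

(** * Counting bad rows by factorial moments *)

Section many_bad_rows.
Local Open Scope ereal_scope.
Context {R : realType} d (T : measurableType d) (P : probability T R).
Context (m n : nat) (W : 'I_m * 'I_n -> T -> R).
Hypothesis hW : forall ij, std_normal_rv P (W ij).

Definition bad_rows (w : T) : {set 'I_m} :=
  [set i | (row_comb W (total_sum W w) i w <= 0)%R]%SET.
Definition many_bad : set T := [set w | (n <= #|bad_rows w|)%N].

Lemma all_badE (B : {set 'I_m}) w : all_bad W B w <-> B \subset bad_rows w.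
Proof.
split => [h|/fintype.subsetP h i iB].
  by apply/fintype.subsetP => i iB; rewrite inE; exact: h.
by have := h i iB; rewrite inE.
Qed.

(** At the point [- S] a row has nonnegative output exactly when it is bad, so [ReLU_not_injective]
    applies. *)
Lemma few_bad_not_injective w : ~ many_bad w ->
  ~ injective (fun x : 'cV[R]_n => ReLU (rand_mx W w *m x)).
Proof.
move=> /negP; rewrite -ltnNge => h.
apply: (@ReLU_not_injective _ _ _ _ (\col_j (- total_sum W w j)%R)).
rewrite (_ : [set i | _]%SET = bad_rows w)//; apply/finset.setP => i.
rewrite !inE !mxE -oppr_le0 -sumrN; congr (_ <= _)%R.
by apply: eq_bigr => j _; rewrite !mxE mulrN opprK mulrC.
Qed.

Lemma measurable_many_bad : measurable many_bad.
Proof.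
rewrite (_ : many_bad = \bigcup_(B in [set B : {set 'I_m} | (n <= #|B|)%N]) all_bad W B).
  by apply: fin_bigcup_measurable => // B _; exact: (measurable_all_bad hW).
apply/seteqP; split => w /=.
  by move=> h; exists (bad_rows w) => //; apply/all_badE.
by move=> [B /= nB /all_badE /subset_leq_card]; exact: leq_trans.
Qed.

(** Markov's inequality for the number of [k]-element sets of bad rows: it is at least ['C(n, k)] on
    [many_bad], and its expectation is a sum of ['C(m, k)] probabilities. *)
Lemma many_bad_moment k (x : R) :
  (forall B : {set 'I_m}, #|B| = k -> P (all_bad W B) <= x%:E) ->
  'C(n, k)%:R%:E * P many_bad <= ('C(m, k)%:R * x)%:E.
Proof.
move=> hx; have mb := measurable_many_bad.
rewrite -[X in P X]setIT -integral_indic// -ge0_integralZl//; last first.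
  exact/measurable_EFinP.
pose D := [set B : {set 'I_m} | #|B| == k]%SET.
apply: (@le_trans _ _ (\int[P]_w (\sum_(B <- enum D) (\1_(all_bad W B) w)%:E))).
  apply: ge0_le_integral => //.
  - by apply: emeasurable_funM => //; apply/measurable_EFinP.
  - apply: emeasurable_sum => B; apply/measurable_EFinP/measurable_indic.
    exact: (measurable_all_bad hW).
  - move=> w _; rewrite sumEFin -EFinM lee_fin.
    rewrite big_enum /=.
    have -> : (\sum_(B in D) \1_(all_bad W B) w = 'C(#|bad_rows w|, k)%:R
        :> R)%R.
      rewrite -cards_draws -sum1_card natr_sum big_mkcond [RHS]big_mkcond /=.
      apply: eq_bigr => B _; rewrite !inE indicE.
      rewrite (_ : (w \in all_bad W B) = (B \subset bad_rows w)).
        by case: (B \subset _); case: (_ == k).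
      by apply/idP/idP => [/set_mem/all_badE//|/all_badE/mem_set].
    rewrite indicE; case: (boolP (w \in many_bad)) => [/set_mem h|_].
      by rewrite mulr1 ler_nat leq_bin2l.
    by rewrite mulr0.
rewrite ge0_integral_sum//; last first.
  by move=> B; apply/measurable_EFinP/measurable_indic; exact: (measurable_all_bad hW).
rewrite big_enum /=; apply: (@le_trans _ _ (\sum_(B in D) x%:E)).
  apply: lee_sum => B; rewrite inE => /eqP Bk.
  by rewrite integral_indic ?setIT ?hx//; exact: (measurable_all_bad hW).
rewrite sumEFin lee_fin sumr_const.
suff -> : #|D| = 'C(m, k) by rewrite mulr_natl.
rewrite -[m in RHS]card_ord -cardsT -cards_draws.
by apply: eq_card => B; rewrite !inE finset.subsetT.
Qed.

End many_bad_rows.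

(** * Bounds for ratios of binomial coefficients *)

Lemma ffact_le_expn n k : (n ^_ k <= n ^ k)%N.
Proof.
elim: k n => [|k IH] [|n] //; rewrite ffactnS expnS leq_mul2l /=.
by apply: leq_trans (IH n) _; case: k {IH} => // k; rewrite leq_exp2r.
Qed.

Lemma expn_le_ffact n k : ((n - k) ^ k <= n ^_ k)%N.
Proof.
elim: k => [//|k IH]; rewrite ffactnSr expnSr leq_mul ?leq_sub2l//.
by apply: leq_trans IH; case: k => // k; rewrite leq_exp2r// leq_sub2l.
Qed.

(** Division-free form of the bound [(m / (n - k)) ^ k] for ['C(m, k) / 'C(n, k)]; clearing the
    factorial leaves falling factorials, which are compared with powers. *)
Lemma bin_ratio_le m n k : ('C(m, k) * (n - k) ^ k <= m ^ k * 'C(n, k))%N.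
Proof.
rewrite -(leq_pmul2l (fact_gt0 k)) mulnA (mulnC (k`!)) bin_ffact.
rewrite (mulnC (k`!)) -mulnA bin_ffact.
by rewrite leq_mul ?ffact_le_expn ?expn_le_ffact.
Qed.

(** * The probability of at least [n] bad rows, and its limit *)

Section many_bad_probability.
Context {R : realType} d (T : measurableType d) (P : probability T R).
Context (m n k : nat) (W : 'I_m * 'I_n -> T -> R).
Hypothesis hW : forall ij, std_normal_rv P (W ij).
Hypothesis indepW : mutually_independent P W.
Local Notation gauss := (@normal_prob R 0 1).

(** Here [c1] bounds [m / n], while the larger [c2] absorbs the loss from [n] to [n - k] in the
    binomial ratio. *)
Lemma many_bad_bound (cs c1 c2 e : R) : 0 < cs ->
  gauss `]-oo, - (1 / Num.sqrt cs)] = (cs^-1)%:E ->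
  0 < e -> e * (k%:R + 2) < 1 -> (1 + e) * c1 <= cs * (1 - e * (k%:R + 2)) ^+ 2 ->
  (0 < k < n)%N -> m%:R <= c1 * n%:R -> c1 * n%:R <= c2 * (n - k)%:R ->
  fine (P (many_bad W)) <= c2 ^+ k * (cs^-1 ^+ k +
    ((k%:R + 2) * chernoff_rate 1 e ^+ n + k%:R * chernoff_rate (-1) e ^+ n)).
Proof.
move=> cs0 csE e0 ek ec /andP[k0 kn] mc cc.
have q1 := chernoff_rate_ge0 1 e; have q2 := chernoff_rate_ge0 (-1) e.
set err := _ + _ * chernoff_rate _ _ ^+ n.
have err0 : 0 <= err by rewrite addr_ge0// mulr_ge0 ?exprn_ge0.
have nk0 : 0 < (n - k)%:R :> R by rewrite ltr0n subn_gt0.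
have n0 : 0 < n%:R :> R by rewrite ltr0n (leq_trans _ kn).
have c20 : 0 <= c2.
  by rewrite -(pmulr_lge0 _ nk0) (le_trans _ cc)// (le_trans _ mc).
have p0 : 0 <= cs^-1 by rewrite invr_ge0 ltW.
have mk := measurable_many_bad hW.
(* With fewer than [n] rows in all the event is empty; otherwise [k < n <= m] supplies the condition
   [k < m] of [all_bad_bound]. *)
have [mn|nm] := ltnP m n.
  rewrite (_ : many_bad W = set0) ?measure0/=.
    by rewrite mulr_ge0 ?exprn_ge0// addr_ge0 ?exprn_ge0.
  apply/seteqP; split => w //=; apply/negP; rewrite -ltnNge.
  by apply: leq_ltn_trans mn; rewrite -[leqRHS]card_ord max_card.
have km : (k < m)%N by exact: leq_trans nm.
have hbad (B : {set 'I_m}) : #|B| = k -> (P (all_bad W B) <= (cs^-1 ^+ k + err)%:E)%E.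
  move=> Bk; rewrite /err addrA -Bk.
  apply: (all_bad_bound hW indepW csE e0); rewrite ?Bk//.
    by rewrite (leq_trans _ kn).
  (* The remaining condition, for [z = 1 / Num.sqrt cs], becomes the hypothesis [ec] after squaring
     and bounding [m - k] by [c1 * n]. *)
  set f := 1 - _ in ec *.
  have f0 : 0 < f by rewrite /f subr_gt0.
  rewrite div1r mulrC ler_pdivrMr ?sqrtr_gt0//.
  rewrite -(ler_pXn2r (n := 2)) ?nnegrE ?sqrtr_ge0 ?mulr_ge0 ?sqrtr_ge0 ?(ltW f0)//.
  rewrite sqr_sqrtr; last by rewrite !mulr_ge0//; lra.
  rewrite !exprMn sqr_sqrtr ?(ltW cs0)//.
    have mk' : (m - k)%:R <= c1 * n%:R by rewrite (le_trans _ mc)// ler_nat leq_subr.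
  apply: (@le_trans _ _ ((1 + e) * n%:R * (c1 * n%:R))).
    by rewrite ler_wpM2l// mulr_ge0//; lra.
  have -> : (1 + e) * n%:R * (c1 * n%:R) = (1 + e) * c1 * n%:R ^+ 2 by ring.
  have -> : n%:R ^+ 2 * f ^+ 2 * cs = cs * f ^+ 2 * n%:R ^+ 2 by ring.
  by rewrite ler_wpM2r ?sqr_ge0.
have := many_bad_moment hW hbad.
rewrite -[X in (_ * X)%E]fineK ?fin_num_measure// -EFinM lee_fin => h.
have Cn : 0 < 'C(n, k)%:R :> R by rewrite ltr0n bin_gt0 ltnW.
have Cm : 'C(m, k)%:R <= c2 ^+ k * 'C(n, k)%:R.
  rewrite -(ler_pM2r (exprn_gt0 k nk0)) -natrX -natrM.
  apply: (@le_trans _ _ (m ^ k * 'C(n, k))%:R); first by rewrite ler_nat bin_ratio_le.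
  rewrite natrM !natrX mulrAC -exprMn ler_wpM2r//.
  by rewrite lerXn2r ?nnegrE ?mulr_ge0// (le_trans mc).
rewrite -(ler_pM2l Cn) (le_trans h)// mulrCA mulrA ler_wpM2r//.
by rewrite addr_ge0 ?exprn_ge0.
Qed.

End many_bad_probability.

(** Measurable events [A n] inside the non-injectivity event make the claim meaningful without
    asserting that this event is itself measurable. They are taken to be the complements of
    [many_bad]. *)
Theorem theorem6 (R : realType) (d : measure_display) (T : measurableType d)
  (P : probability T R) (m : nat -> nat) (c cstar : R)
  (W : forall n : nat, 'I_(m n) * 'I_n -> T -> R) :
                                                                           
  0 < cstar ->
  erfc (1 / Num.sqrt (2 * cstar)) / 2 = 1 / cstar ->
  (forall y : R, 0 < y -> erfc (1 / Num.sqrt (2 * y)) / 2 = 1 / y -> y = cstar) ->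
                           
  ((m n)%:R / n%:R @[n --> \oo] --> c) ->
                                                       
  (forall n ij, std_normal_rv P (W n ij)) ->
  (forall n, mutually_independent P (W n)) ->
  c < cstar ->
                                                                            
                                                   
  exists A : nat -> set T,
    (forall n, measurable (A n)) /\
    (forall n, A n `<=` [set w | ~ injective
                           (fun x : 'cV[R]_n => ReLU (rand_mx (W n) w *m x))]) /\
    ((fun n => fine (P (A n))) @ \oo --> (1 : R)).
Proof.
move=> cs0 csE _ mc hW iW ccs.
have sqcs : 1 / Num.sqrt cstar / Num.sqrt 2 = 1 / Num.sqrt (2 * cstar).
  by rewrite sqrtrM// !div1r invfM mulrC.
(* The equation for [cstar] says that the normal tail at [1 / Num.sqrt cstar] has mass
   [1 / cstar]. *)
have tail : normal_prob 0 1 `]-oo, - (1 / Num.sqrt cstar)] = (cstar^-1)%:E.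
  by rewrite std_normal_tail ?sqcs ?csE ?div1r// invr_ge0 sqrtr_ge0.
have mb n := measurable_many_bad (hW n).
exists (fun n => ~` many_bad (W n)); split; last split.
- by move=> n; exact: measurableC.
- by move=> n w; exact: few_bad_not_injective.
have pC n : fine (P (~` many_bad (W n))) = 1 - fine (P (many_bad (W n))).
  by rewrite probability_setC// fineB ?fin_num_measure.
under eq_fun do rewrite pC.
suff h : fine (P (many_bad (W n))) @[n --> \oo] --> (0 : R).
  have := @cvgB _ R^o _ _ _ _ _ _ _ (cvg_cst (1 : R)) h.
  rewrite subr0; exact.
apply/cvgrPdist_lt => x x0.
(* Clamping at [0] makes the intermediate constants [c < c1 < c2 < cstar] positive. *)
pose c0 := Num.max c 0.
have c00 : 0 <= c0 by rewrite le_max lexx orbT.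
have cc0 : c <= c0 by rewrite le_max lexx.
have c0s : c0 < cstar by rewrite gt_max ccs.
pose c1 := (2 * c0 + cstar) / 3; pose c2 := (c0 + 2 * cstar) / 3.
have c10 : 0 < c1 by rewrite /c1; lra.
have c01 : c < c1 by rewrite /c1; lra.
have c12 : c1 < c2 by rewrite /c1 /c2; lra.
have c2s : c2 < cstar by rewrite /c2; lra.
have c20 : 0 < c2 by lra.
have r0 : 0 <= c2 / cstar by rewrite divr_ge0// ltW.
have r1 : `|c2 / cstar| < 1 by rewrite ger0_norm// ltr_pdivrMr// mul1r.
(* The moment order [k] is fixed before [n] grows, with the main term below [x / 2]. *)
have [k k0 hk] : exists2 k, (0 < k)%N & (c2 / cstar) ^+ k < x / 2.
  have /cvgrPdist_lt/(_ _ (divr_gt0 x0 (ltr0n _ 2)))[N _ hN] := cvg_expr r1.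
  exists N.+1 => //; have := hN N.+1 (leqnSn N).
  by rewrite /= sub0r normrN ger0_norm// exprn_ge0.
(* This [e] solves [(1 + e) * c1 = cstar * (1 - 2 * e * (k%:R + 2))], the linearization of [ec]; the
   omitted square is nonnegative. *)
pose e := (cstar - c1) / (c1 + 2 * cstar * (k%:R + 2)).
have kR : 0 <= k%:R :> R by [].
have den0 : 0 < c1 + 2 * cstar * (k%:R + 2) by rewrite addr_gt0// !mulr_gt0//; lra.
have e0 : 0 < e by rewrite divr_gt0//; lra.
have eE : e * c1 + 2 * cstar * (e * (k%:R + 2)) = cstar - c1.
  by rewrite /e; field; rewrite gt_eqF.
have ek : e * (k%:R + 2) < 1.
  have : 0 < e * c1 by rewrite mulr_gt0.
  by nra.
have e1 : e <= 1.
  have : 0 <= e * k%:R by rewrite mulr_ge0// ltW.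
  by lra.
have ec : (1 + e) * c1 <= cstar * (1 - e * (k%:R + 2)) ^+ 2.
  have : 0 <= cstar * (e * (k%:R + 2)) ^+ 2 by rewrite mulr_ge0 ?sqr_ge0// ltW.
  by nra.
(* With [k] and [e] fixed, this is a combination of two geometric sequences of ratio below one. *)
pose err (n : nat) := c2 ^+ k * ((k%:R + 2) * chernoff_rate 1 e ^+ n +
  k%:R * chernoff_rate (-1) e ^+ n).
have err_cvg : err n @[n --> \oo] --> (0 : R).
  have q (sg : R) : sg ^+ 2 = 1 -> chernoff_rate sg e ^+ n @[n --> \oo] --> (0 : R).
    move=> sg2; apply: cvg_expr; rewrite ger0_norm ?chernoff_rate_ge0//.
    exact: chernoff_rate_lt1.
  have cq (y sg : R) : sg ^+ 2 = 1 ->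
      y * chernoff_rate sg e ^+ n @[n --> \oo] --> (0 : R).
    move=> sg2; rewrite -(mulr0 y); apply: cvgM; first exact: cvg_cst.
    exact: q.
  rewrite -(mulr0 (c2 ^+ k)); apply: cvgM; first exact: cvg_cst.
  rewrite -(addr0 0); apply: cvgD; apply: cq; first by rewrite expr1n.
  by rewrite sqrrN expr1n.
near=> n.
have kn : (k < n)%N by near: n; exact: nbhs_infty_gt.
have n0 : 0 < n%:R :> R by rewrite ltr0n (leq_trans _ kn).
have mn : (m n)%:R <= c1 * n%:R.
  rewrite -ler_pdivrMr// ltW//; near: n.
  by move/cvgr_lt: mc; apply.
(* Equivalent to [n] being at least [c2 * k / (c2 - c1)], a fixed number. *)
have cn : c1 * n%:R <= c2 * (n - k)%:R.
  rewrite natrB ?(ltnW kn)// mulrBr lerBrDr -lerBrDl -mulrBl -ler_pdivrMl ?subr_gt0//.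
  by near: n; exact: nbhs_infty_ger.
have errn : err n < x / 2.
  by near: n; move/cvgr_lt: err_cvg; apply; rewrite divr_gt0.
rewrite sub0r normrN ger0_norm ?fine_ge0//.
have := many_bad_bound (hW n) (iW n) cs0 tail e0 ek ec _ mn cn.
rewrite k0 kn => /(_ isT); rewrite mulrDr -/(err n) -exprMn => h.
by rewrite (le_lt_trans h)//; lra.
Unshelve. all: by end_near. Qed.
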